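(* Let $k,n$ be positive integers. For $N\ge1$ let $\mathcal{F}_{N,1}$ be the family of functions $u:\{-N,\dots,N\}\to\mathbb{R}$ with $u(j)=u(-j)$ for all $j$ and $\sum_{j=-N}^{N}u(j)=1$, and let $\mathcal{F}_{N,2}$ be the subfamily of those $u\in\mathcal{F}_{N,1}$ with $\widehat u(\xi)\ge0$ for all $\xi\in\mathbb{T}$. For $j\in\{1,2\}$ and positive integers $m,N$ let $$C_{m,N,j}=\inf_{u\in\mathcal{F}_{N,j}}\ \sup_{0\neq f\in\ell^2(\mathbb{Z})}\frac{\|\nabla^{m}(u\ast f)\|_{\ell^2(\mathbb{Z})}}{\|f\|_{\ell^2(\mathbb{Z})}}.$$ Then $C_{k,n,1}^2=C_{2k,2n,2}$. Moreover, there exists a unique $u\in\mathcal{F}_{n,1}$ such that $$C_{k,n,1}=\sup_{0\neq f\in\ell^2(\mathbb{Z})}\frac{\|\nabla^{k}(u\ast f)\|_{\ell^2(\mathbb{Z})}}{\|f\|_{\ell^2(\mathbb{Z})}},$$ and $u\ast u$ is the only kernel in $\mathcal{F}_{2n,2}$ satisfying $$C_{2k,2n,2}=\sup_{0\neq f\in\ell^2(\mathbb{Z})}\frac{\|\nabla^{2k}((u\ast u)\ast f)\|_{\ell^2(\mathbb{Z})}}{\|f\|_{\ell^2(\mathbb{Z})}}.$$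
   Context: Functions on $\{-N,\dots,N\}$ are regarded as functions on $\mathbb{Z}$ vanishing outside it; $\nabla g(k)=g(k+1)-g(k)$, $\nabla^{m}=\nabla(\nabla^{m-1})$; $(u\ast f)(k)=\sum_ju(j)f(k-j)$; $\mathbb{T}=\mathbb{R}/2\pi\mathbb{Z}$; $\widehat u(\xi)=\sum_ku(k)e^{-ik\xi}$. Suprema are over nonzero complex-valued $f\in\ell^2(\mathbb{Z})$. *)

(* Defs.v *)
From Stdlib Require Import Reals ZArith.
From Coquelicot Require Import Coquelicot.
Open Scope R_scope.

(* Index j_i = i - N for i = 0 .. 2N enumerates {-N, ..., N}. *)
Definition idx (N i : nat) : Z := (Z.of_nat i - Z.of_nat N)%Z.

Definition symsumR (N : nat) (a : Z -> R) : R :=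
  sum_n (fun i => a (idx N i)) (2 * N).

Definition symsumC (N : nat) (a : Z -> C) : C :=
  sum_n (fun i => a (idx N i)) (2 * N).

(* Convolution (u * f)(k) = sum_j u(j) f(k-j), for u vanishing outside {-N..N}
   (so the sum reduces to j in {-N..N}). *)
Definition conv (N : nat) (u : Z -> R) (f : Z -> C) (k : Z) : C :=
  symsumC N (fun j => Cmult (RtoC (u j)) (f (k - j)%Z)).

Definition convR (N : nat) (u v : Z -> R) (k : Z) : R :=
  symsumR N (fun j => u j * v (k - j)%Z).

Definition nabla (g : Z -> C) (k : Z) : C := Cminus (g (k + 1)%Z) (g k).
Definition nabla_pow (m : nat) (g : Z -> C) : Z -> C := Nat.iter m nabla g.

Definition in_l2 (g : Z -> C) : Prop :=
  ex_series (fun n : nat => (Cmod (g (Z.of_nat n))) ^ 2) /\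
  ex_series (fun n : nat => (Cmod (g (- Z.of_nat (S n))%Z)) ^ 2).

Definition l2norm (g : Z -> C) : R :=
  sqrt (Series (fun n : nat => (Cmod (g (Z.of_nat n))) ^ 2) +
        Series (fun n : nat => (Cmod (g (- Z.of_nat (S n))%Z)) ^ 2)).

(* Fourier transform  hat u (xi) = sum_k u(k) e^{-i k xi}, u supported in {-N..N}. *)
Definition uhat (N : nat) (u : Z -> R) (xi : R) : C :=
  symsumC N (fun j => Cmult (RtoC (u j))
                  (cos (IZR j * xi), - sin (IZR j * xi))).

Definition inF1 (N : nat) (u : Z -> R) : Prop :=
  (forall j : Z, (Z.of_nat N < Z.abs j)%Z -> u j = 0) /\
  (forall j : Z, u j = u (- j)%Z) /\
  symsumR N u = 1.

Definition inF2 (N : nat) (u : Z -> R) : Prop :=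
  inF1 N u /\ forall xi : R, Im (uhat N u xi) = 0 /\ 0 <= Re (uhat N u xi).

Definition Fam (j N : nat) (u : Z -> R) : Prop :=
  match j with
  | 1%nat => inF1 N u
  | 2%nat => inF2 N u
  | _ => False
  end.

Definition opnorm (m N : nat) (u : Z -> R) : Rbar :=
  Lub_Rbar (fun r : R => exists f : Z -> C,
    in_l2 f /\ (exists k : Z, f k <> RtoC 0) /\
    r = l2norm (nabla_pow m (conv N u f)) / l2norm f).

Definition Cconst (m N j : nat) : Rbar :=
  Glb_Rbar (fun r : R => exists u : Z -> R, Fam j N u /\ opnorm m N u = Finite r).

(* Main.v *)
Require Import Defs.
From Stdlib Require Import Reals ZArith Lra Lia List FinFun Sorted.
From Stdlib Require Import Classical ClassicalEpsilon FunctionalExtensionality.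
From Coquelicot Require Import Coquelicot.
Open Scope R_scope.

(** The operator [f |-> nabla^m (u * f)] is a Fourier multiplier, so its norm is the maximum of
    its symbol.  For even [u] supported in {-N..N}, [uhat u xi = p (cos xi)] with [p] an arbitrary
    polynomial of degree at most [N], and the squared symbol is [(2 - 2 cos xi)^m p(cos xi)^2].
    Both problems thus concern the weight [W x = (2 - 2 x)^k] on [[-1, 1]]: minimise
    [max W p^2] over [deg p <= n], [p 1 = 1], respectively [max W q] over [deg q <= 2 n],
    [q 1 = 1], [q >= 0].  A minimiser [p] of the first problem has [n + 1] alternating extremal
    points; they interlace with [n] zeros of [p].  If [q] does not exceed the value [max W p^2],
    then [p^2 - q] is nonnegative at the extremal points, nonpositive at the zeros, and zero at
    [1]: it weakly alternates at [2 n + 2] points, hence [q = p^2].  This gives the value and the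
    uniqueness in the second problem, and uniqueness in the first by applying it to [q = p'^2]
    and to the square of [(p + p') / 2]. *)

(** * Polynomial functions *)

Lemma choice {A B : Type} (P : A -> B -> Prop) :
  (forall x, exists y, P x y) -> exists f, forall x, P x (f x).
Proof.
  intros H. exists (fun x => proj1_sig (constructive_indefinite_description _ (H x))).
  intros x. apply proj2_sig.
Qed.

(** Horner form, with [d] an upper bound for the degree. Being a predicate on functions, it
    identifies polynomials through their values, and coefficients are never compared. *)
Fixpoint is_poly (d : nat) (f : R -> R) : Prop :=
  match d with
  | O => exists c, forall x, f x = c
  | S d' => exists c g, is_poly d' g /\ forall x, f x = c + x * g x
  end.

Lemma is_poly_ext d f g : (forall x, f x = g x) -> is_poly d f -> is_poly d g.
Proof.
  destruct d; simpl.
  - intros E [c H]; exists c; intros x; rewrite <- E; auto.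
  - intros E (c & h & Hh & H); exists c, h; split; auto.
    intros x; rewrite <- E; auto.
Qed.

Lemma is_poly_const d c : is_poly d (fun _ => c).
Proof.
  revert c; induction d as [|d IH]; intros c; simpl.
  - now exists c.
  - exists c, (fun _ => 0); split; auto. intros; ring.
Qed.

Lemma is_poly_S d f : is_poly d f -> is_poly (S d) f.
Proof.
  revert f; induction d as [|d IH]; intros f H.
  - destruct H as [c H]. exists c, (fun _ => 0); split; [now exists 0|].
    intros x; rewrite H; ring.
  - destruct H as (c & g & Hg & H). exists c, g; split; auto.
Qed.

Lemma is_poly_le d e f : (d <= e)%nat -> is_poly d f -> is_poly e f.
Proof. induction 1; auto using is_poly_S. Qed.

Lemma is_poly_plus d f g : is_poly d f -> is_poly d g -> is_poly d (fun x => f x + g x).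
Proof.
  revert f g; induction d as [|d IH]; intros f g.
  - intros [c H] [c' H']; exists (c + c'); intros x; rewrite H, H'; auto.
  - intros (c & h & Hh & H) (c' & h' & Hh' & H').
    exists (c + c'), (fun x => h x + h' x); split; auto.
    intros x; rewrite H, H'; ring.
Qed.

Lemma is_poly_scal d a f : is_poly d f -> is_poly d (fun x => a * f x).
Proof.
  revert f; induction d as [|d IH]; intros f.
  - intros [c H]; exists (a * c); intros x; rewrite H; auto.
  - intros (c & h & Hh & H). exists (a * c), (fun x => a * h x); split; auto.
    intros x; rewrite H; ring.
Qed.

Lemma is_poly_mulX d f : is_poly d f -> is_poly (S d) (fun x => x * f x).
Proof. intros H; exists 0, f; split; auto. intros; ring. Qed.

Lemma is_poly_mul_affine d a b f : is_poly d f -> is_poly (S d) (fun x => (a + b * x) * f x).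
Proof.
  intros H.
  apply is_poly_ext with (fun x => a * f x + b * (x * f x)); [intros; ring|].
  apply is_poly_plus; [apply is_poly_S|]; apply is_poly_scal; auto using is_poly_mulX.
Qed.

Lemma is_poly_mult d e f g : is_poly d f -> is_poly e g -> is_poly (d + e) (fun x => f x * g x).
Proof.
  revert f; induction d as [|d IH]; intros f.
  - intros [c H] Hg. apply is_poly_ext with (fun x => c * g x).
    + intros; rewrite H; auto.
    + simpl; auto using is_poly_scal.
  - intros (c & h & Hh & H) Hg.
    apply is_poly_ext with (fun x => c * g x + x * (h x * g x)).
    + intros; rewrite H; ring.
    + apply is_poly_plus.
      * apply is_poly_le with e; [lia|]; auto using is_poly_scal.
      * apply (is_poly_mulX (d + e)); auto.
Qed.

Lemma is_poly_pow d f k : is_poly d f -> is_poly (k * d) (fun x => f x ^ k).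
Proof.
  intros H; induction k as [|k IH].
  - simpl. now exists 1.
  - simpl. apply (is_poly_mult d (k * d)); auto.
Qed.

Lemma is_poly_continuity d f : is_poly d f -> continuity f.
Proof.
  revert f; induction d as [|d IH]; intros f.
  - intros [c H] x. apply continuity_pt_ext with (fun _ => c); auto.
    apply continuity_pt_const; intros ? ?; auto.
  - intros (c & g & Hg & H) x.
    apply continuity_pt_ext with (fun x => c + x * g x); auto.
    apply continuity_pt_plus.
    + apply continuity_pt_const; intros ? ?; auto.
    + apply continuity_pt_mult; [apply continuity_pt_id|apply IH; auto].
Qed.

(** Induction on the Horner form: if [g x = g a + (x - a) * h x], then [x * g x - a * g a] equals
    [(x - a) * (g a + x * h x)]. *)
Lemma is_poly_factor d f a : is_poly (S d) f ->
  exists g, is_poly d g /\ forall x, f x = f a + (x - a) * g x.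
Proof.
  revert f; induction d as [|d IH]; intros f (c & g & Hg & H).
  - exists g; split; auto. destruct Hg as [b Hb].
    intros x; rewrite !H, !Hb; ring.
  - destruct (IH _ Hg) as (h & Hh & E).
    exists (fun x => g a + x * h x); split.
    + exists (g a), h; auto.
    + intros x; rewrite (H x), (H a), (E x); ring.
Qed.

Lemma is_poly_finite_roots d f x0 : is_poly d f -> f x0 <> 0 ->
  exists l, forall x, f x = 0 -> In x l.
Proof.
  revert f; induction d as [|d IH]; intros f Hf H0.
  - exists nil. destruct Hf as [c H]. intros x; rewrite H, <- (H x0); auto.
  - destruct (classic (exists a, f a = 0)) as [[a Ha]|Hn].
    + destruct (is_poly_factor d f a Hf) as (g & Hg & E).
      destruct (IH g Hg) as [l Hl].
      { intros Z; apply H0. rewrite E, Ha, Z; ring. }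
      exists (a :: l). intros x Hx. rewrite E, Ha, Rplus_0_l in Hx.
      destruct (Rmult_integral _ _ Hx); [left; lra|right; auto].
    + exists nil. intros x Hx. apply Hn; eauto.
Qed.

(** * Compactness of polynomials of bounded degree *)

Lemma is_lim_seq_inv_succ : is_lim_seq (fun j => / (INR j + 1)) 0.
Proof.
  replace (Finite 0) with (Rbar_inv p_infty) by auto.
  apply is_lim_seq_inv; [|discriminate].
  apply is_lim_seq_plus with p_infty 1; [apply is_lim_seq_INR|apply is_lim_seq_const|reflexivity].
Qed.

(** A subsequence is given by an index map with [j <= phi j]; such a map may fail to increase, but
    it still preserves limits at infinity. *)
Lemma bounded_subseq (u : nat -> R) (B : R) : (forall j, Rabs (u j) <= B) ->
  exists (phi : nat -> nat) (l : R),
    (forall j, (j <= phi j)%nat) /\ is_lim_seq (fun j => u (phi j)) l.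
Proof.
  intros HB.
  destruct (Bolzano_Weierstrass u (fun x => -B <= x <= B)) as [l Hl].
  - apply compact_P3.
  - intros j. specialize (HB j). split; [apply Rabs_le_between in HB|apply Rabs_le_between in HB]; lra.
  - assert (P : forall j : nat, exists i, (j <= i)%nat /\ Rabs (u i - l) < / (INR j + 1)).
    { intros j.
      assert (0 < / (INR j + 1)) as Hpos by (apply Rinv_0_lt_compat; pose proof (pos_INR j); lra).
      destruct (Hl (disc l (mkposreal _ Hpos)) j) as (i & Hi & D).
      - exists (mkposreal _ Hpos). intros x Hx; exact Hx.
      - exists i; split; auto. }
    apply choice in P. destruct P as [phi P].
    exists phi, l; split; [intros; apply P|].
    apply is_lim_seq_spec. intros eps.
    assert (L := is_lim_seq_inv_succ).
    apply is_lim_seq_spec in L. destruct (L eps) as [N HN].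
    exists N. intros j Hj. eapply Rlt_trans; [apply P|].
    specialize (HN j Hj). rewrite Rminus_0_r in HN.
    eapply Rle_lt_trans; [apply Rle_abs|exact HN].
Qed.

Lemma is_lim_seq_reindex (u : nat -> R) (phi : nat -> nat) (l : Rbar) :
  (forall j, (j <= phi j)%nat) -> is_lim_seq u l -> is_lim_seq (fun j => u (phi j)) l.
Proof.
  intros H. apply (is_lim_seq_subseq u).
  intros P [N HN]. exists N. intros j Hj. apply HN. specialize (H j); lia.
Qed.

(** Values at [d + 1] distinct nodes control everything. After splitting off the node [a], the
    quotients of [f j - f j a] by [x - a] stay bounded at the remaining nodes, which differ from
    [a]; induction extracts a limit of the quotients, and a further subsequence makes the values at
    [a] converge. *)
Lemma is_poly_compact d (l : list R) (f : nat -> R -> R) :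
  NoDup l -> length l = S d -> (forall j, is_poly d (f j)) ->
  (forall a, In a l -> exists B, forall j, Rabs (f j a) <= B) ->
  exists (phi : nat -> nat) g, (forall j, (j <= phi j)%nat) /\ is_poly d g /\
    forall x, is_lim_seq (fun j => f (phi j) x) (g x).
Proof.
  revert l f; induction d as [|d IH]; intros [|a l] f Hl Hlen Hf HB; simpl in Hlen; try lia.
  - destruct (HB a) as [B Ha]; [now left|].
    destruct (bounded_subseq (fun j => f j a) B Ha) as (phi & c & H1 & H2).
    exists phi, (fun _ => c); repeat split; auto.
    + now exists c.
    + intros x. eapply is_lim_seq_ext; [|exact H2].
      intros j. destruct (Hf (phi j)) as [e He]; now rewrite !He.
  - inversion Hl as [|? ? Hna Hl']; subst.
    destruct (HB a) as [B Ha]; [now left|].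
    assert (G : forall j, exists g, is_poly d g /\ forall x, f j x = f j a + (x - a) * g x)
      by (intros; apply is_poly_factor; auto).
    apply choice in G. destruct G as [g G].
    destruct (IH l g) as (phi & h & P1 & P2 & P3); auto.
    { intros; apply G. }
    { intros b Hb. destruct (HB b) as [B' Hb']; [now right|].
      assert (Nab : b - a <> 0) by (intros E; apply Hna; replace a with b by lra; auto).
      exists ((B' + B) / Rabs (b - a)). intros j.
      apply Rle_div_r; [now apply Rabs_pos_lt|].
      rewrite <- Rabs_mult. destruct (G j) as [_ E]. specialize (E b).
      replace (g j b * (b - a)) with (f j b - f j a) by (rewrite E; ring).
      eapply Rle_trans; [apply Rabs_triang|]. rewrite Rabs_Ropp.
      specialize (Ha j); specialize (Hb' j); lra. }
    destruct (bounded_subseq (fun j => f (phi j) a) B) as (psi & c & Q1 & Q2); [auto|].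
    exists (fun j => phi (psi j)), (fun x => c + (x - a) * h x); repeat split.
    + intros j; specialize (P1 (psi j)); specialize (Q1 j); lia.
    + apply is_poly_plus; [apply is_poly_const|].
      apply is_poly_ext with (fun x => (- a + 1 * x) * h x); [intros; ring|].
      apply is_poly_mul_affine; auto.
    + intros x. eapply is_lim_seq_ext.
      * intros j. symmetry. apply (proj2 (G (phi (psi j))) x).
      * apply is_lim_seq_plus'; auto.
        apply (is_lim_seq_scal_l _ (x - a) (h x)).
        apply (is_lim_seq_reindex (fun j => g (phi j) x)); auto.
Qed.

(** The nodes avoid 1, so that the weight is positive at each of them and a bound on the weighted
    square bounds the polynomial. *)
Lemma exists_nodes n : exists l, NoDup l /\ length l = n /\ forall a : R, In a l -> -1 <= a < 1.
Proof.
  exists (map (fun i => - / INR (S i)) (seq 0 n)); repeat split.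
  - apply Injective_map_NoDup; [|apply seq_NoDup].
    intros i j E. apply Ropp_eq_compat in E. rewrite !Ropp_involutive in E.
    apply Rinv_eq_reg in E. apply INR_eq in E; lia.
  - now rewrite length_map, length_seq.
  - apply in_map_iff in H as (i & <- & _).
    assert (/ INR (S i) <= / 1); [|lra].
    apply Rinv_le_contravar; [lra|]. rewrite S_INR; pose proof (pos_INR i); lra.
  - apply in_map_iff in H as (i & <- & _).
    assert (0 < / INR (S i)); [|lra].
    apply Rinv_0_lt_compat, lt_0_INR; lia.
Qed.

(** * The weighted extremal problem *)

(** At [x = cos xi] this is the squared modulus of [(exp(i xi) - 1)^k], the symbol of the [k]-th
    difference. *)
Definition wt (k : nat) (x : R) : R := (2 - 2 * x) ^ k.

Lemma wt_pos k x : x < 1 -> 0 < wt k x.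
Proof. intros; apply pow_lt; lra. Qed.

Lemma wt_ge0 k x : x <= 1 -> 0 <= wt k x.
Proof. intros; apply pow_le; lra. Qed.

Lemma wt_1 k : (0 < k)%nat -> wt k 1 = 0.
Proof. intros; unfold wt. replace (2 - 2 * 1) with 0 by ring. apply pow_i; auto. Qed.

Lemma is_poly_wt k : is_poly k (wt k).
Proof.
  replace k with (k * 1)%nat at 1 by lia.
  apply (is_poly_pow 1 (fun x => 2 - 2 * x)).
  exists 2, (fun _ => -2); split; [now exists (-2)|]. intros; ring.
Qed.

Definition below (k : nat) (p : R -> R) (c : R) : Prop :=
  forall x, -1 <= x <= 1 -> wt k x * p x ^ 2 <= c.

(** A minimising sequence is bounded at nodes where the weight is positive; a subsequence converges
    pointwise, and the bound passes to its limit. *)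
Lemma minimizer_exists k n : exists p M,
  is_poly n p /\ p 1 = 1 /\ 0 < M /\ below k p M /\
  forall p' c, is_poly n p' -> p' 1 = 1 -> below k p' c -> M <= c.
Proof.
  (* Bounds are negated because [completeness] yields suprema; the minimum is [- m]. *)
  set (A := fun c => exists p, is_poly n p /\ p 1 = 1 /\ below k p (- c)).
  assert (A0 : forall c, A c -> c <= 0).
  { intros c (p & _ & _ & H). specialize (H (-1)).
    assert (0 <= wt k (-1) * p (-1) ^ 2)
      by (apply Rmult_le_pos; [apply wt_ge0; lra|apply pow2_ge_0]).
    lra. }
  destruct (completeness A) as [m [U L]].
  { exists 0. exact A0. }
  { exists (- 4 ^ k). exists (fun _ => 1); repeat split; [apply is_poly_const|].
    intros x Hx. replace (wt k x * 1 ^ 2) with (wt k x) by ring.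
    rewrite Ropp_involutive. apply pow_incr; lra. }
  assert (G : forall j : nat, exists p, is_poly n p /\ p 1 = 1 /\ below k p (- m + / (INR j + 1))).
  { intros j. apply NNPP; intros Hn.
    assert (Hp : 0 < / (INR j + 1)) by (apply Rinv_0_lt_compat; pose proof (pos_INR j); lra).
    assert (m <= m - / (INR j + 1)); [|lra].
    apply L. intros c (p & P1 & P2 & P3). destruct (Rle_dec c (m - / (INR j + 1))); auto.
    exfalso; apply Hn; exists p; repeat split; auto.
    intros x Hx. specialize (P3 x Hx). lra. }
  apply choice in G. destruct G as [f G].
  destruct (exists_nodes (S n)) as (l & L1 & L2 & L3).
  destruct (is_poly_compact n l f) as (phi & p & P1 & P2 & P3); auto.
  { intros; apply G. }
  (* The bound comes from [|t| <= 1 + t ^ 2] and [wt k a * f j a ^ 2 <= - m + 1]. *)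
  { intros a Ha. exists (1 + (- m + 1) / wt k a). intros j.
    assert (Ha' := L3 a Ha).
    destruct (G j) as (_ & _ & Q). specialize (Q a ltac:(lra)).
    assert (W := wt_pos k a ltac:(lra)).
    assert (/ (INR j + 1) <= 1).
    { apply Rle_trans with (/ 1); [|lra].
      apply Rinv_le_contravar; [lra|]. pose proof (pos_INR j); lra. }
    assert (f j a ^ 2 <= (- m + 1) / wt k a).
    { apply (Rle_div_r (f j a ^ 2)); auto. rewrite Rmult_comm. lra. }
    apply Rle_trans with (1 + f j a ^ 2); [|apply Rplus_le_compat_l; auto].
    apply Rabs_le; split; nra. }
  assert (Hb : below k p (- m)).
  { intros x Hx.
    refine (is_lim_seq_le (fun j => wt k x * f (phi j) x ^ 2) (fun j => - m + / (INR j + 1)) (Finite _) (Finite _) _ _ _).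
    - intros j. destruct (G (phi j)) as (_ & _ & Q). specialize (Q x Hx).
      eapply Rle_trans; [exact Q|]. apply Rplus_le_compat_l.
      apply Rinv_le_contravar; [pose proof (pos_INR j); lra|].
      apply Rplus_le_compat_r, le_INR; auto.
    - apply (is_lim_seq_scal_l _ _ (Finite _)).
      apply is_lim_seq_ext with (fun j => f (phi j) x * f (phi j) x); [intros; ring|].
      replace (p x ^ 2) with (p x * p x) by ring.
      apply is_lim_seq_mult'; auto.
    - replace (Finite (- m)) with (Finite (- m + 0)) by (f_equal; ring).
      apply is_lim_seq_plus'; [apply is_lim_seq_const|apply is_lim_seq_inv_succ]. }
  assert (H1 : p 1 = 1).
  { assert (E := is_lim_seq_unique _ _ (P3 1)).
    rewrite (Lim_seq_ext _ (fun _ => 1)) in E by (intros; apply G).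
    rewrite Lim_seq_const in E. congruence. }
  exists p, (- m); repeat split; auto.
  (* Were the minimum 0, [p] would vanish on all of [[-1, 1)], hence at more nodes than a list of
     all its roots has entries. *)
  - assert (m <= 0) by (apply L; exact A0).
    destruct (Req_dec m 0) as [->|]; [|lra]. exfalso.
    destruct (is_poly_finite_roots n p 1 P2 ltac:(lra)) as [r Hr].
    destruct (exists_nodes (S (length r))) as (l' & N1 & N2 & N3).
    assert (length l' <= length r)%nat; [|lia].
    apply NoDup_incl_length; auto.
    intros a Ha. apply Hr. specialize (N3 a Ha). specialize (Hb a ltac:(lra)).
    assert (W := wt_pos k a ltac:(lra)). assert (0 <= p a ^ 2) by apply pow2_ge_0.
    assert (p a ^ 2 = 0) by nra. nra.
  - intros p' c Q1 Q2 Q3. assert (- c <= m); [|lra].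
    apply U. exists p'; repeat split; auto. rewrite Ropp_involutive; auto.
Qed.

(** Kolmogorov's criterion: if [h] has the sign of [p] at all extremal points, then [p - s * h]
    improves on [p] for small [s]. By compactness, at every point either [g], half the rate of
    decrease, or the slack [e] is bounded below by a common [d]. *)
Lemma perturbation k n p M h : is_poly n p -> p 1 = 1 -> 0 < M -> (0 < k)%nat ->
  below k p M -> is_poly n h -> h 1 = 0 ->
  (forall x, -1 <= x < 1 -> wt k x * p x ^ 2 = M -> 0 < h x * p x) ->
  exists p' c, is_poly n p' /\ p' 1 = 1 /\ below k p' c /\ c < M.
Proof.
  intros Hp p1 HM Hk Hb Hh h1 Hpos.
  assert (CW : continuity (wt k)) by (eapply is_poly_continuity, is_poly_wt).
  assert (Cp : continuity p) by (eapply is_poly_continuity; eauto).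
  assert (Ch : continuity h) by (eapply is_poly_continuity; eauto).
  set (g := fun x => wt k x * (h x * p x)).
  set (e := fun x => M - wt k x * (p x * p x)).
  assert (Cg : continuity g) by (repeat apply continuity_mult; auto).
  assert (Ce : continuity e).
  { apply continuity_minus; [apply continuity_const; intros ? ?; auto|].
    repeat apply continuity_mult; auto. }
  assert (Ca : continuity (fun x => wt k x * (h x * h x))) by (repeat apply continuity_mult; auto).
  assert (Emax : exists d, 0 < d /\ forall x, -1 <= x <= 1 -> d <= g x \/ d <= e x).
  (* [c] is the maximum of [g] and [e], in a form whose continuity is immediate. *)
  { set (c := fun x => (g x + e x + Rabs (g x - e x)) * / 2).
    assert (Cc : continuity c).
    { apply continuity_mult; [|apply continuity_const; intros ? ?; auto].
      apply continuity_plus; [apply continuity_plus; auto|].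
      apply (continuity_comp (fun x => g x - e x) Rabs); [apply continuity_minus; auto|apply Rcontinuity_abs]. }
    assert (Ec : forall x, c x = Rmax (g x) (e x)).
    { intros x; unfold c, Rmax, Rabs; destruct (Rle_dec (g x) (e x)), (Rcase_abs (g x - e x)); lra. }
    destruct (continuity_ab_min c (-1) 1) as (x0 & H0 & Hx0); [lra|intros; apply Cc|].
    exists (c x0); split.
    - rewrite Ec. assert (He : 0 <= e x0) by (specialize (Hb x0 Hx0); unfold e; nra).
      destruct (Req_dec (e x0) 0) as [E|E].
      + eapply Rlt_le_trans; [|apply Rmax_l].
        (* The point 1 is not extremal: the weight vanishes there and [e 1 = M]. *)
        destruct (Req_dec x0 1) as [->|N].
        { unfold e in E; rewrite wt_1 in E; auto; lra. }
        apply Rmult_lt_0_compat; [apply wt_pos; lra|].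
        apply Hpos; [lra|]. unfold e in E; nra.
      + eapply Rlt_le_trans; [|apply Rmax_r]. lra.
    - intros x Hx. specialize (H0 x Hx). rewrite (Ec x) in H0.
      unfold Rmax in H0; destruct (Rle_dec (g x) (e x)); lra. }
  destruct Emax as (d & Hd & Hor).
  destruct (continuity_ab_maj (fun x => wt k x * (h x * h x)) (-1) 1) as (xa & Ha & _); [lra|intros; apply Ca|].
  destruct (continuity_ab_min g (-1) 1) as (xb & Hbd & _); [lra|intros; apply Cg|].
  cbv beta in Ha. set (a := wt k xa * (h xa * h xa)) in *.
  set (B := Rabs a + Rabs (g xb) + 1).
  assert (Ba : a <= B) by (unfold B; pose proof (Rle_abs a); pose proof (Rabs_pos (g xb)); lra).
  assert (Bg : - B <= g xb)
    by (unfold B; pose proof (Rle_abs (- g xb)); rewrite Rabs_Ropp in *; pose proof (Rabs_pos a); lra).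
  assert (B1 : 0 < B) by (unfold B; pose proof (Rabs_pos (g xb)); pose proof (Rabs_pos a); lra).
  (* This gives [s < 1] and [s * B <= d / 4]. Where [d <= g x], the gain [2 * s * d] beats the
     quadratic term, at most [s * d / 4]; where [d <= e x], the slack [d] absorbs
     [2 * s * B + s * s * B <= 3 * d / 4]. *)
  set (s := d / (4 * B + d)).
  assert (Hs : 0 < s) by (apply Rdiv_lt_0_compat; lra).
  assert (sE : s * (4 * B + d) = d) by (unfold s; field; lra).
  assert (s1 : s < 1) by nra.
  assert (sB : s * B <= d / 4) by nra.
  exists (fun x => p x + - s * h x), (M - Rmin (s * d) (d / 4)); repeat split.
  - apply is_poly_plus; auto using is_poly_scal.
  - rewrite p1, h1; ring.
  - intros x Hx. specialize (Ha x Hx). specialize (Hbd x Hx). specialize (Hb x Hx).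
    replace (wt k x * (p x + - s * h x) ^ 2) with
      (wt k x * p x ^ 2 - 2 * s * g x + s * s * (wt k x * (h x * h x))) by (unfold g; ring).
    assert (s * s * (wt k x * (h x * h x)) <= s * s * B) by (apply Rmult_le_compat_l; nra).
    assert (s * s * B <= s * d / 4) by nra.
    destruct (Hor x Hx) as [Q|Q].
    + pose proof (Rmin_l (s * d) (d / 4)).
      assert (s * d <= s * g x) by (apply Rmult_le_compat_l; lra). nra.
    + pose proof (Rmin_r (s * d) (d / 4)). unfold e in Q.
      assert (s * - B <= s * g x) by (apply Rmult_le_compat_l; lra). nra.
  - assert (0 < Rmin (s * d) (d / 4)) by (apply Rmin_glb_lt; nra). lra.
Qed.

(** * Sorted points and alternating signs *)

Lemma insert_sorted (a : R) l : StronglySorted Rlt l ->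
  exists l', StronglySorted Rlt l' /\ forall x, In x l' <-> x = a \/ In x l.
Proof.
  induction l as [|b l IH]; intros H.
  - exists (a :: nil); split; [repeat constructor|]. simpl; intuition.
  - inversion H as [|? ? Hl Hb]; subst.
    destruct (Rtotal_order a b) as [L|[->|L]].
    + exists (a :: b :: l); split.
      * constructor; auto. constructor; auto.
        eapply Forall_impl; [|exact Hb]. intros; simpl in *; lra.
      * simpl; intuition.
    + exists (b :: l); split; auto. simpl; intuition.
    + destruct (IH Hl) as (l' & S' & I'). exists (b :: l'); split.
      * constructor; auto. apply Forall_forall; intros x Hx.
        apply I' in Hx as [->|Hx]; auto. rewrite Forall_forall in Hb; auto.
      * intros x; simpl; rewrite I'; intuition.
Qed.

Lemma sorted_listing (Q : R -> Prop) l : (forall x, Q x -> In x l) ->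
  exists l', StronglySorted Rlt l' /\ forall x, In x l' <-> Q x.
Proof.
  revert Q; induction l as [|a l IH]; intros Q H.
  - exists nil; split; [constructor|]. intros x; split; [now intros []|apply H].
  - destruct (IH (fun x => Q x /\ x <> a)) as (l' & S' & I').
    { intros x [Hx N]. destruct (H x Hx); [congruence|auto]. }
    destruct (classic (Q a)) as [Ha|Ha].
    + destruct (insert_sorted a l' S') as (m & Sm & Im). exists m; split; auto.
      intros x; rewrite Im, I'. destruct (Req_dec x a); subst; intuition.
    + exists l'; split; auto. intros x; rewrite I'. intuition congruence.
Qed.

(** Only the sign of [s] matters. A real number is allowed so that a value such as [p x] can
    prescribe the sign at the first point. *)
Fixpoint alternates (s : R) (f : R -> R) (l : list R) : Prop :=
  match l with
  | nil => True
  | t :: l' => 0 < s * f t /\ alternates (- s) f l'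
  end.

Fixpoint weakly_alternates (s : R) (f : R -> R) (l : list R) : Prop :=
  match l with
  | nil => True
  | t :: l' => 0 <= s * f t /\ weakly_alternates (- s) f l'
  end.

Lemma alternates_scale s s' f l : 0 < s * s' -> alternates s f l -> alternates s' f l.
Proof.
  revert s s'; induction l as [|t l IH]; intros s s' H; simpl; auto.
  intros [H1 H2]; split.
  - assert (0 < (s * s') * (s * f t)) by (apply Rmult_lt_0_compat; auto).
    assert (0 < s * s) by nra. nra.
  - apply IH with (- s); auto; nra.
Qed.

(** To the right of [z] the factor [x - z] is positive and leaves all signs alone. *)
Lemma weakly_alternates_divide s f g z l : (forall x, f x = (x - z) * g x) ->
  (forall t, In t l -> z < t) -> weakly_alternates s f l -> weakly_alternates s g l.
Proof.
  intros E; revert s; induction l as [|t l IH]; intros s Hz; simpl; auto.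
  intros [H1 H2]; split; [|apply IH; auto; intros; apply Hz; now right].
  specialize (Hz t (or_introl eq_refl)). rewrite E in H1.
  destruct (Rle_dec 0 (s * g t)); auto. nra.
Qed.

(* There is a root [z] in [[a, b]].  If [z < b], divide by it and drop [a]; if [z = b], dividing flips
   the sign at [a] only, so that dropping [b] restores the alternation. *)
Lemma weakly_alternating_zero d f l s : is_poly d f -> StronglySorted Rlt l ->
  length l = S (S d) -> s <> 0 -> weakly_alternates s f l -> forall x, f x = 0.
Proof.
  revert f l s; induction d as [|d IH]; intros f [|a [|b l]] s Hf Hl Hlen Hs; simpl in Hlen; try lia.
  - intros (H1 & H2 & _) x. destruct Hf as [c Hc]. rewrite Hc in *.
    destruct (Rtotal_order s 0) as [|[|]]; nra.
  - intros H.
    inversion Hl as [|? ? Hl1 Ha]; subst. inversion Hl1 as [|? ? Hl2 Hb]; subst.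
    rewrite Forall_forall in Ha, Hb.
    assert (Hab : a < b) by (apply Ha; now left).
    assert (K : (exists z, a <= z < b /\ f z = 0) \/ f b = 0).
    { destruct H as (H1 & H2 & _).
      destruct (IVT_cor f a b) as (z & Hz & E).
      - eapply is_poly_continuity; eauto.
      - lra.
      - assert (0 < s * s) by nra.
        assert (0 <= (s * f a) * (- s * f b)) by (apply Rmult_le_pos; auto).
        destruct (Rle_dec (f a * f b) 0); auto. nra.
      - destruct (Req_dec z b); [right; congruence|left; exists z; split; auto; lra]. }
    destruct K as [(z & Hz & Ez)|Eb].
    + destruct (is_poly_factor d f z Hf) as (g & Hg & E).
      assert (E' : forall x, f x = (x - z) * g x) by (intros x; rewrite E, Ez; ring).
      intros x. rewrite E'.
      rewrite (IH g (b :: l) (- s)); auto; try lra.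
      apply weakly_alternates_divide with f z; auto; [|apply H].
      intros t [<-|Ht]; [lra|]. specialize (Hb t Ht); lra.
    + destruct (is_poly_factor d f b Hf) as (g & Hg & E).
      assert (E' : forall x, f x = (x - b) * g x) by (intros x; rewrite E, Eb; ring).
      intros x. rewrite E'.
      rewrite (IH g (a :: l) (- s)); auto; try lra.
      * constructor; auto. apply Forall_forall; intros; apply Ha; now right.
      * destruct H as (H1 & _ & H3). split.
        { rewrite E' in H1. destruct (Rle_dec 0 (- s * g a)); auto. nra. }
        apply weakly_alternates_divide with f b; auto.
Qed.

(* Each sign change of [p] along [E] costs [h] one degree and gives [A] one point. *)
Lemma separate_or_alternate p x E : StronglySorted Rlt (x :: E) ->
  (forall t, In t (x :: E) -> p t <> 0) ->
  exists m h A, is_poly m h /\ (forall t, In t (x :: E) -> 0 < h t * p t) /\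
    (forall t, t <= x -> 0 < h t * h x) /\
    length A = m /\ StronglySorted Rlt (x :: A) /\ incl A E /\ alternates (p x) p (x :: A).
Proof.
  revert x; induction E as [|y E IH]; intros x Hs Hp.
  - exists O, (fun _ => p x), nil; repeat split; auto.
    + now exists (p x).
    + intros t [<-|[]]. specialize (Hp x (or_introl eq_refl)). nra.
    + intros. specialize (Hp x (or_introl eq_refl)). nra.
    + apply incl_refl.
    + simpl. specialize (Hp x (or_introl eq_refl)). nra.
  - inversion Hs as [|? ? Hs' Hx]; subst. rewrite Forall_forall in Hx.
    assert (Hxy : x < y) by (apply Hx; now left).
    destruct (IH y Hs') as (m & h & A & H1 & H2 & H3 & H4 & H5 & H6 & H7 & H8).
    { intros; apply Hp; now right. }
    assert (Px : p x <> 0) by (apply Hp; now left).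
    assert (Py : 0 < h y * p y) by (apply H2; now left).
    assert (Qx : 0 < h x * h y) by (apply H3; lra).
    assert (R1 : 0 < h x * p y).
    { assert (0 < (h x * h y) * (h y * p y)) by (apply Rmult_lt_0_compat; auto).
      assert (0 < h y * h y) by nra. nra. }
    assert (SA : StronglySorted Rlt (x :: A)).
    { inversion H5; subst. constructor; auto. apply Forall_forall; intros t Ht.
      apply Hx; right; auto. }
    (* With equal signs at [x] and [y], [x] replaces [y] at the head of the alternating list and [h]
       is kept. Otherwise [h] gets a further root midway between [x] and [y], and [y] joins [A]. *)
    destruct (Rlt_dec 0 (p x * p y)) as [L|L].
    + exists m, h, A. split; [auto|split; [|split; [|split; [auto|split; [auto|split]]]]].
      * intros t [<-|Ht]; auto.
        assert (0 < (h x * p y) * (p x * p y)) by (apply Rmult_lt_0_compat; auto).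
        assert (0 < p y * p y) by nra. nra.
      * intros t Ht. assert (0 < h t * h y) by (apply H3; lra).
        assert (0 < (h t * h y) * (h x * h y)) by (apply Rmult_lt_0_compat; auto).
        assert (0 < h y * h y) by nra. nra.
      * intros t Ht; right; auto.
      * split; [nra|]. apply alternates_scale with (- p y); auto; nra.
    + assert (Py0 : p y <> 0) by (intros Z; rewrite Z in Py; lra).
      assert (L' : p x * p y < 0) by (assert (p x * p y <> 0) by (apply Rmult_integral_contrapositive; auto); lra).
      exists (S m), (fun t => (- ((x + y) / 2) + 1 * t) * h t), (y :: A).
      split; [apply is_poly_mul_affine; auto|split; [|split; [|split; [|split; [|split]]]]].
      * intros t [<-|Ht].
        { assert (h x * p x < 0).
          { assert (0 < (h x * p y) * - (p x * p y)) by (apply Rmult_lt_0_compat; lra).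
            assert (0 < p y * p y) by nra. nra. }
          rewrite Rmult_assoc. nra. }
        rewrite Rmult_assoc. apply Rmult_lt_0_compat; auto.
        assert (y <= t); [|lra]. destruct Ht as [->|Ht]; [lra|].
        inversion Hs' as [|? ? ? Q]; subst. rewrite Forall_forall in Q. specialize (Q t Ht); lra.
      * intros t Ht. assert (0 < h t * h y) by (apply H3; lra).
        assert (0 < h t * h x).
        { assert (0 < (h t * h y) * (h x * h y)) by (apply Rmult_lt_0_compat; auto).
          assert (0 < h y * h y) by nra. nra. }
        replace (_ * _) with ((((x + y) / 2 - t) * ((x + y) / 2 - x)) * (h t * h x)) by ring.
        apply Rmult_lt_0_compat; auto. apply Rmult_lt_0_compat; lra.
      * simpl; auto.
      * constructor; auto. apply Forall_forall; intros t [<-|Ht]; auto.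
        inversion SA as [|? ? ? Q]; subst. rewrite Forall_forall in Q; auto.
      * intros t [<-|Ht]; [now left|right; auto].
      * split; [exact (Rsqr_pos_lt _ Px)|].
        apply (alternates_scale (p y) (- p x) p (y :: A)); [lra|split; auto].
Qed.

Lemma firstn_sorted (l : list R) m : StronglySorted Rlt l -> StronglySorted Rlt (firstn m l).
Proof.
  revert m; induction l as [|a l IH]; intros [|m] H; simpl; try constructor.
  - inversion H; auto.
  - inversion H as [|? ? ? Q]; subst. rewrite Forall_forall in *. intros t Ht.
    apply Q. rewrite <- (firstn_skipn m l). apply in_or_app; auto.
Qed.

Lemma firstn_alternates s f l m : alternates s f l -> alternates s f (firstn m l).
Proof. revert s m; induction l; intros s [|m]; simpl; intuition. Qed.

(** Between consecutive alternation points [p] has a zero, where [r] is nonpositive, while [r] is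
    nonnegative at the points themselves. The list ends with 1, where [r = 0] fits either sign. So
    [B] holds the points of [A], as many zeros, and 1. *)
Lemma interlace p r x A s : continuity p -> StronglySorted Rlt (x :: A) -> alternates s p (x :: A) ->
  (forall t, In t (x :: A) -> t < 1 /\ 0 <= r t) -> r 1 = 0 ->
  (forall z, x <= z <= 1 -> p z = 0 -> r z <= 0) ->
  exists B, StronglySorted Rlt (x :: B) /\ length B = (2 * length A + 1)%nat /\
    weakly_alternates 1 r (x :: B).
Proof.
  intros Cp; revert x s; induction A as [|y A IH]; intros x s Hs Ha Hin r1 Hz.
  - exists (1 :: nil). destruct (Hin x (or_introl eq_refl)). split; [|split; auto].
    + repeat constructor; auto.
    + simpl. rewrite r1. repeat split; lra.
  - inversion Hs as [|? ? Hs' Hx]; subst. rewrite Forall_forall in Hx.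
    assert (Hxy : x < y) by (apply Hx; now left).
    destruct Ha as (Ha1 & Ha2). destruct (Hin x (or_introl eq_refl)) as [X1 X2].
    destruct (Hin y (or_intror (or_introl eq_refl))) as [Y1 Y2].
    destruct (IH y (- s)) as (B & B1 & B2 & B3); auto.
    { intros; apply Hin; now right. }
    { intros z ? ?; apply Hz; auto; lra. }
    destruct Ha2 as [Ha2 _].
    destruct (IVT_cor p x y Cp) as (z & Hz1 & Ez); [lra| |].
    { assert (0 < (s * p x) * (- s * p y)) by (apply Rmult_lt_0_compat; auto).
      assert (s <> 0) by (intros ->; lra). assert (0 < s * s) by nra. nra. }
    assert (z <> x) by (intros ->; rewrite Ez in Ha1; lra).
    assert (z <> y) by (intros ->; rewrite Ez in Ha2; lra).
    exists (z :: y :: B). split; [|split].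
    + assert (Fy : forall t, In t (y :: B) -> y <= t).
      { intros t [<-|Ht]; [lra|]. inversion B1 as [|? ? ? Q]; subst.
        rewrite Forall_forall in Q. specialize (Q t Ht); lra. }
      constructor; [constructor; auto|]; apply Forall_forall.
      * intros t Ht. specialize (Fy t Ht); lra.
      * intros t [<-|Ht]; [lra|]. specialize (Fy t Ht); lra.
    + simpl in *; lia.
    + assert (r z <= 0) by (apply Hz; auto; lra).
      split; [lra|]. split; [lra|]. rewrite Ropp_involutive; auto.
Qed.

Theorem extremal_polynomial k n : (0 < k)%nat -> (0 < n)%nat -> exists p M,
  is_poly n p /\ p 1 = 1 /\ 0 < M /\ below k p M /\
  (exists x, -1 <= x <= 1 /\ wt k x * p x ^ 2 = M) /\
  forall q, is_poly (2 * n) q -> q 1 = 1 -> (forall x, -1 <= x <= 1 -> 0 <= q x) ->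
    (forall x, -1 <= x <= 1 -> wt k x * q x <= M) -> forall x, q x = p x ^ 2.
Proof.
  intros Hk Hn. destruct (minimizer_exists k n) as (p & M & P1 & P2 & P3 & P4 & P5).
  exists p, M. split; [auto|split; [auto|split; [auto|split; [auto|]]]].
  set (Q := fun x => -1 <= x < 1 /\ wt k x * p x ^ 2 = M).
  (* The extremal points are roots of [wt k x * p x ^ 2 - M], which is not the zero polynomial since
     its value at 1 is [- M]. *)
  assert (Hfin : exists E, StronglySorted Rlt E /\ forall x, In x E <-> Q x).
  { destruct (is_poly_finite_roots (k + 2 * n) (fun x => wt k x * p x ^ 2 + - M) 1) as [l Hl].
    - apply is_poly_plus; [|apply is_poly_const].
      apply is_poly_mult; [apply is_poly_wt|apply is_poly_pow; auto].
    - rewrite wt_1; auto; lra.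
    - apply sorted_listing with l. intros x [_ Hx]. apply Hl; lra. }
  (* The factor [1 - x] turns [h] into a direction vanishing at 1 with the same signs to the left of
     1; [perturbation] then contradicts minimality. *)
  assert (Hno : forall h, is_poly (n - 1) h -> ~ forall x, Q x -> 0 < h x * p x).
  { intros h Hh Hpos.
    destruct (perturbation k n p M (fun x => (1 + -1 * x) * h x)) as (p' & c & Q1 & Q2 & Q3 & Q4); auto.
    - replace n with (S (n - 1)) by lia. apply is_poly_mul_affine; auto.
    - ring.
    - intros x Hx Ex. rewrite Rmult_assoc. apply Rmult_lt_0_compat; [lra|]. apply Hpos; split; auto.
    - specialize (P5 p' c Q1 Q2 Q3); lra. }
  destruct Hfin as ([|x E] & SE & IE).
  { exfalso. apply (Hno (fun _ => 0)); [apply is_poly_const|]. intros x Hx; apply IE in Hx as []. }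
  split.
  { exists x. destruct (proj1 (IE x) (or_introl eq_refl)); split; auto; lra. }
  destruct (separate_or_alternate p x E SE) as (m & h & A & H1 & H2 & H3 & H4 & H5 & H6 & H7).
  { intros t Ht Z. apply IE in Ht as [_ Ht]. rewrite Z in Ht. lra. }
  (* With fewer than [n] sign changes, the separating polynomial [h] would have degree at most
     [n - 1]. *)
  destruct (le_lt_dec n m) as [Lm|Lm].
  2:{ exfalso; apply (Hno h); [apply is_poly_le with m; auto; lia|]. intros t Ht; apply H2, IE; auto. }
  intros q Hq q1 q0 qM.
  set (r := fun x => p x ^ 2 + -1 * q x).
  assert (InA : forall t, In t (x :: firstn n A) -> Q t).
  { intros t [<-|Ht]; apply IE; [now left|right; apply H6].
    rewrite <- (firstn_skipn n A). apply in_or_app; auto. }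
  (* Exactly [n] points of [A] are kept, so [x :: B] has [2 * n + 2] points, two more than the
     degree bound of [r]. *)
  destruct (interlace p r x (firstn n A) (p x)) as (B & B1 & B2 & B3).
  - eapply is_poly_continuity; eauto.
  - apply (firstn_sorted (x :: A) (S n)); auto.
  - apply (firstn_alternates _ _ (x :: A) (S n)); auto.
  - intros t Ht. destruct (InA t Ht) as [T1 T2]. split; [lra|].
    specialize (qM t ltac:(lra)). pose proof (wt_pos k t ltac:(lra)). unfold r.
    assert (wt k t * q t <= wt k t * p t ^ 2) by lra.
    apply Rmult_le_reg_l in H0; auto; lra.
  - unfold r; rewrite P2, q1; ring.
  - intros z Hz Ez. unfold r; rewrite Ez. destruct (InA x (or_introl eq_refl)) as [X _].
    specialize (q0 z ltac:(lra)); lra.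
  - rewrite length_firstn in B2.
    assert (Z : forall t, r t = 0).
    { apply (weakly_alternating_zero (2 * n) r (x :: B) 1); auto; try lra.
      - apply is_poly_plus; [apply is_poly_pow; auto|apply is_poly_scal; auto].
      - simpl length. lia. }
    intros t. specialize (Z t). unfold r in Z. lra.
Qed.

(** * Symmetric sums and the discrete Fourier transform *)

(* Sums over [C] produce equations between elements of the carrier of a canonical structure, which [ring] does not recognise. *)
Ltac ringC := match goal with |- ?a = ?b => change (@eq C a b) end; ring.

(** Generic in the monoid, so that each identity is proved once; [symsumR] and [symsumC] are
    instances by conversion. *)
Definition symsum {G : AbelianMonoid} (N : nat) (a : Z -> G) : G :=
  sum_n (fun i => a (idx N i)) (2 * N).

Lemma symsum_S {G : AbelianMonoid} N (a : Z -> G) :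
  symsum (S N) a = plus (a (- Z.of_nat (S N))%Z) (plus (symsum N a) (a (Z.of_nat (S N)))).
Proof.
  unfold symsum. replace (2 * S N)%nat with (S (S (2 * N))) by lia.
  rewrite sum_Sn. unfold sum_n at 1. rewrite sum_Sn_m by lia.
  rewrite <- sum_n_m_S. rewrite <- plus_assoc. apply f_equal2; [|apply f_equal2].
  - f_equal; unfold idx; lia.
  - apply sum_n_ext; intros i. f_equal; unfold idx; lia.
  - f_equal; unfold idx; lia.
Qed.

Lemma symsum_0 {G : AbelianMonoid} (a : Z -> G) : symsum 0 a = a 0%Z.
Proof. unfold symsum. now rewrite sum_O. Qed.

Lemma symsum_ext {G : AbelianMonoid} N (a b : Z -> G) :
  (forall j, (Z.abs j <= Z.of_nat N)%Z -> a j = b j) -> symsum N a = symsum N b.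
Proof. intros H; apply sum_n_ext_loc; intros i Hi; apply H; unfold idx; lia. Qed.

Lemma symsum_extend {G : AbelianMonoid} N K (a : Z -> G) : (N <= K)%nat ->
  (forall j, (Z.of_nat N < Z.abs j)%Z -> a j = zero) -> symsum K a = symsum N a.
Proof.
  intros L H; induction L as [|K L IH]; auto.
  rewrite symsum_S, IH, (H (Z.of_nat (S K))), (H (- Z.of_nat (S K))%Z) by lia.
  now rewrite plus_zero_l, plus_zero_r.
Qed.

Lemma symsum_opp {G : AbelianMonoid} N (a : Z -> G) :
  symsum N (fun j => a (- j)%Z) = symsum N a.
Proof.
  induction N as [|N IH]; [now rewrite !symsum_0|].
  rewrite !symsum_S, IH, Z.opp_involutive.
  rewrite plus_assoc, plus_comm, (plus_comm (a (Z.of_nat (S N)))). reflexivity.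
Qed.

(** A shift by one step that keeps both boundary terms; support conditions enter when it is
    iterated. *)
Lemma symsum_telescope {G : AbelianMonoid} K (a : Z -> G) :
  plus (a (- Z.of_nat K)%Z) (symsum K (fun j => a (j + 1)%Z)) =
  plus (symsum K a) (a (Z.of_nat K + 1)%Z).
Proof.
  induction K as [|K IH]; [now rewrite !symsum_0|].
  rewrite !symsum_S.
  replace (- Z.of_nat (S K) + 1)%Z with (- Z.of_nat K)%Z by lia.
  rewrite (plus_assoc (a (- Z.of_nat K)%Z)), IH.
  replace (Z.of_nat K + 1)%Z with (Z.of_nat (S K)) by lia.
  now rewrite <- !plus_assoc.
Qed.

Lemma symsum_shift_nat {G : AbelianMonoid} s K (a : Z -> G) :
  (forall j, (Z.of_nat K < Z.abs j + Z.of_nat s)%Z -> a j = zero) ->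
  symsum K (fun j => a (j + Z.of_nat s)%Z) = symsum K a.
Proof.
  induction s as [|s IH]; intros H.
  - apply symsum_ext; intros; f_equal; lia.
  - rewrite <- IH by (intros; apply H; lia).
    generalize (symsum_telescope K (fun j => a (j + Z.of_nat s)%Z)).
    rewrite (H (- Z.of_nat K + Z.of_nat s)%Z), (H (Z.of_nat K + 1 + Z.of_nat s)%Z) by lia.
    rewrite plus_zero_l, plus_zero_r. intros <-.
    apply symsum_ext; intros; f_equal; lia.
Qed.

(** By hypothesis [a] is supported where [|j| <= K - |s|], so the shift moves no nonzero value out
    of the window. *)
Lemma symsum_shift {G : AbelianMonoid} (s : Z) K (a : Z -> G) :
  (forall j, (Z.of_nat K < Z.abs j + Z.abs s)%Z -> a j = zero) ->
  symsum K (fun j => a (j - s)%Z) = symsum K a.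
Proof.
  intros H. destruct (Z.le_ge_cases s 0) as [L|L].
  - rewrite <- (symsum_shift_nat (Z.to_nat (- s)) K a) by (intros; apply H; lia).
    apply symsum_ext; intros; f_equal; lia.
  - rewrite <- (symsum_opp K a), <- (symsum_opp K (fun j => a (j - s)%Z)).
    rewrite <- (symsum_shift_nat (Z.to_nat s) K (fun j => a (- j)%Z)) by (intros; apply H; lia).
    apply symsum_ext; intros; f_equal; lia.
Qed.

Lemma symsum_plus {G : AbelianMonoid} N (a b : Z -> G) :
  symsum N (fun j => plus (a j) (b j)) = plus (symsum N a) (symsum N b).
Proof. apply sum_n_plus. Qed.

Lemma symsum_mult_l {K : Ring} N c (a : Z -> K) :
  symsum N (fun j => mult c (a j)) = mult c (symsum N a).
Proof. apply (sum_n_mult_l c). Qed.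

Lemma symsum_switch {G : AbelianMonoid} N M (a : Z -> Z -> G) :
  symsum N (fun i => symsum M (a i)) = symsum M (fun j => symsum N (fun i => a i j)).
Proof. apply sum_n_switch. Qed.

Lemma symsumC_symsum N a : symsumC N a = symsum N a.
Proof. reflexivity. Qed.

Lemma symsumR_symsum N a : symsumR N a = symsum N a.
Proof. reflexivity. Qed.

Lemma symsumC_plus N a b : symsumC N (fun j => Cplus (a j) (b j)) = Cplus (symsumC N a) (symsumC N b).
Proof. apply (@symsum_plus C_AbelianMonoid). Qed.

Lemma symsumC_mult_l N c a : symsumC N (fun j => Cmult c (a j)) = Cmult c (symsumC N a).
Proof. apply (@symsum_mult_l C_Ring). Qed.

Lemma RtoC_sum_n (a : nat -> R) n : RtoC (sum_n a n) = sum_n (fun i => RtoC (a i)) n.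
Proof.
  induction n as [|n IH]; [now rewrite !sum_O|].
  rewrite !sum_Sn, <- IH. apply RtoC_plus.
Qed.

Lemma RtoC_symsum N a : RtoC (symsumR N a) = symsumC N (fun j => RtoC (a j)).
Proof. apply RtoC_sum_n. Qed.

(** * Complex exponentials and the discrete Parseval identity *)

Definition cexp (t : R) : C := (cos t, sin t).

Lemma cexp_plus s t : cexp (s + t) = Cmult (cexp s) (cexp t).
Proof. unfold cexp, Cmult; simpl. rewrite cos_plus, sin_plus. f_equal; ring. Qed.

Lemma cexp_0 : cexp 0 = RtoC 1.
Proof. unfold cexp, RtoC. now rewrite cos_0, sin_0. Qed.

Lemma cexp_opp t : cexp (- t) = (cos t, - sin t).
Proof. unfold cexp. now rewrite cos_neg, sin_neg. Qed.

Lemma cexp_conj t : Cconj (cexp t) = cexp (- t).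
Proof. rewrite cexp_opp. reflexivity. Qed.

Lemma Cmod_cexp t : Cmod (cexp t) = 1.
Proof.
  unfold Cmod, cexp; simpl. replace (_ + _) with 1; [apply sqrt_1|].
  pose proof (sin2_cos2 t). unfold Rsqr in *. lra.
Qed.

Lemma cexp_sym t : Cplus (cexp (- t)) (cexp t) = RtoC (2 * cos t).
Proof. rewrite cexp_opp. unfold cexp, Cplus, RtoC; simpl. f_equal; ring. Qed.

Lemma cexp_pow t n : cexp (INR n * t) = Cpow (cexp t) n.
Proof.
  induction n as [|n IH].
  - simpl. rewrite Rmult_0_l. apply cexp_0.
  - rewrite S_INR, Rmult_plus_distr_r, Rmult_1_l, cexp_plus, IH. simpl. ring.
Qed.

Lemma cexp_eq_1 (z : Z) (L : nat) : (0 < L)%nat ->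
  cexp (IZR z * (2 * PI / INR L)) = RtoC 1 -> exists q, z = (q * Z.of_nat L)%Z.
Proof.
  (* Half the angle is used: [cos (2 * x) = 1] means [sin x = 0], and the zeros of the sine are the
     integer multiples of [PI]. *)
  intros HL E. set (x := IZR z * (PI / INR L)).
  assert (HL' : INR L <> 0) by (apply not_0_INR; lia).
  assert (Ex : IZR z * (2 * PI / INR L) = 2 * x) by (unfold x; field; auto).
  rewrite Ex in E. injection E as Ec _. rewrite cos_2a_sin in Ec.
  assert (Es : sin x = 0) by nra.
  apply sin_eq_0_0 in Es as [q Hq]. exists q. apply eq_IZR.
  rewrite mult_IZR, <- INR_IZR_INZ.
  assert (PI <> 0) by (pose proof PI_RGT_0; lra).
  apply Rmult_eq_reg_r with (PI / INR L).
  - fold x. rewrite Hq. field; auto.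
  - unfold Rdiv. apply Rmult_integral_contrapositive; split; auto using Rinv_neq_0_compat.
Qed.

Lemma geometric_sum (z : C) n :
  Cmult (Cminus z (RtoC 1)) (sum_n (fun l => Cpow z l) n) = Cminus (Cpow z (S n)) (RtoC 1).
Proof.
  induction n as [|n IH].
  - rewrite sum_O. simpl. ring.
  - rewrite sum_Sn. change plus with Cplus.
    rewrite Cmult_plus_distr_l, IH. simpl. ring.
Qed.

(** A geometric sum whose ratio [w] satisfies [w ^ (D + 1) = 1]. The bound [|z| <= D] leaves 0 as
    the only multiple of [D + 1], so [w <> 1] for any other [z]. *)
Lemma roots_of_unity_orthogonality D (z : Z) : (Z.abs z <= Z.of_nat D)%Z ->
  sum_n (fun l => cexp (INR l * (IZR z * (2 * PI / INR (S D))))) D =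
  if Z.eq_dec z 0 then RtoC (INR (S D)) else RtoC 0.
Proof.
  intros Hz.
  rewrite (sum_n_ext _ _ D (fun l => cexp_pow (IZR z * (2 * PI / INR (S D))) l)).
  destruct (Z.eq_dec z 0) as [->|N].
  - rewrite (sum_n_ext _ (fun _ => RtoC 1)).
    + rewrite <- (RtoC_sum_n (fun _ => 1)), sum_n_const, Rmult_1_r. reflexivity.
    + intros l. rewrite Rmult_0_l, cexp_0. apply Cpow_1_l.
  - set (w := cexp _).
    assert (Hw : Cminus w (RtoC 1) <> RtoC 0).
    { intros E. assert (E1 : w = RtoC 1) by (replace w with (Cplus (Cminus w (RtoC 1)) (RtoC 1)) by ring; rewrite E; ring).
      apply cexp_eq_1 in E1 as [q Hq]; [|lia].
      assert (q <> 0%Z) by (intros ->; lia).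
      assert (Z.abs z = Z.abs q * Z.of_nat (S D))%Z by (rewrite Hq, Z.abs_mul; lia).
      nia. }
    assert (G := geometric_sum w D).
    assert (E : Cpow w (S D) = RtoC 1).
    { unfold w. rewrite <- cexp_pow.
      replace (INR (S D) * (IZR z * (2 * PI / INR (S D)))) with (2 * IZR z * PI)
        by (field; apply not_0_INR; lia).
      unfold cexp. destruct z as [|p|p]; [lia| |].
      - replace (2 * IZR (Z.pos p) * PI) with (0 + 2 * INR (Pos.to_nat p) * PI)
          by (rewrite INR_IZR_INZ, positive_nat_Z; ring).
        rewrite cos_period, sin_period, cos_0, sin_0; auto.
      - replace (2 * IZR (Z.neg p) * PI) with (- (0 + 2 * INR (Pos.to_nat p) * PI))
          by (rewrite INR_IZR_INZ, positive_nat_Z, <- Pos2Z.opp_pos, opp_IZR; ring).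
        rewrite cos_neg, sin_neg, cos_period, sin_period, cos_0, sin_0, Ropp_0; auto. }
    rewrite E in G.
    replace (Cminus (RtoC 1) (RtoC 1)) with (RtoC 0) in G by ring.
    apply NNPP; intros Hs. exact (Cmult_neq_0 _ _ Hw Hs G).
Qed.

Lemma sum_n_Kronecker (h : nat -> C) n i : (i <= n)%nat ->
  sum_n (fun j => if Nat.eq_dec i j then h j else RtoC 0) n = h i.
Proof.
  assert (Z0 : forall m, (m < i)%nat -> sum_n (fun j => if Nat.eq_dec i j then h j else RtoC 0) m = RtoC 0).
  { induction m as [|m IH]; intros Hm.
    - rewrite sum_O. destruct (Nat.eq_dec i 0); auto; lia.
    - rewrite sum_Sn, IH by lia. destruct (Nat.eq_dec i (S m)); try lia. apply Cplus_0_l. }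
  induction n as [|n IH]; intros Hi.
  - rewrite sum_O. destruct (Nat.eq_dec i 0); [now subst|lia].
  - rewrite sum_Sn. destruct (Nat.eq_dec i (S n)) as [->|N].
    + rewrite Z0 by lia. apply Cplus_0_l.
    + rewrite IH by lia. apply Cplus_0_r.
Qed.

Lemma Cconj_sum_n (a : nat -> C) n : Cconj (sum_n a n) = sum_n (fun i => Cconj (a i)) n.
Proof.
  induction n as [|n IH]; [now rewrite !sum_O|].
  rewrite !sum_Sn, <- IH. apply Cplus_conj.
Qed.

(** Each squared modulus is expanded into a double sum over [a] and [b]; summing over the
    frequencies first leaves the diagonal, by orthogonality. *)
Lemma parseval_nat D (h : nat -> C) :
  sum_n (fun l => Cmod (sum_n (fun a => Cmult (h a) (cexp (- (INR a * (INR l * (2 * PI / INR (S D))))))) D) ^ 2) D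
  = INR (S D) * sum_n (fun a => Cmod (h a) ^ 2) D.
Proof.
  apply RtoC_inj. rewrite RtoC_mult, !RtoC_sum_n.
  set (w := 2 * PI / INR (S D)).
  rewrite (sum_n_ext _ (fun l => sum_n (fun a => sum_n (fun b =>
     Cmult (Cmult (h a) (Cconj (h b))) (cexp (INR l * (IZR (Z.of_nat b - Z.of_nat a) * w)))) D) D)).
  2:{ intros l. rewrite Cmod2_conj, Cconj_sum_n.
      rewrite <- (@sum_n_mult_r C_Ring). apply sum_n_ext; intros a.
      rewrite <- (@sum_n_mult_l C_Ring). apply sum_n_ext; intros b.
      change mult with Cmult. rewrite Cmult_conj, cexp_conj.
      replace (INR l * (IZR (Z.of_nat b - Z.of_nat a) * w)) with
        (- (INR a * (INR l * w)) + - - (INR b * (INR l * w))).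
      - rewrite cexp_plus. ringC.
      - rewrite minus_IZR, <- !INR_IZR_INZ. ring. }
  rewrite sum_n_switch. rewrite <- (@sum_n_mult_l C_Ring).
  apply sum_n_ext_loc; intros a Ha. rewrite sum_n_switch.
  rewrite (sum_n_ext_loc _ (fun b => if Nat.eq_dec a b then
     (fun b => Cmult (Cmult (h a) (Cconj (h b))) (RtoC (INR (S D)))) b else RtoC 0)).
  - rewrite sum_n_Kronecker by auto. rewrite Cmod2_conj. apply Cmult_comm.
  - intros b Hb. rewrite (@sum_n_mult_l C_Ring).
    unfold w; rewrite roots_of_unity_orthogonality by lia.
    change mult with Cmult.
    destruct (Z.eq_dec _ 0), (Nat.eq_dec a b); try lia; auto. apply Cmult_0_r.
Qed.

(** A finite sum over a window, which is the full transform once the window contains the support of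
    [g]. *)
Definition fourier (K : nat) (g : Z -> C) (xi : R) : C :=
  symsumC K (fun j => Cmult (g j) (cexp (- (IZR j * xi)))).

Definition energy (K : nat) (g : Z -> C) : R := symsumR K (fun j => Cmod (g j) ^ 2).

(** Sampling [2 * K + 1] equidistant frequencies replaces the integral over the circle. Moving the
    window to [{0..2K}] changes the transform by the factor [cexp (INR K * xi)], of modulus 1. *)
Lemma parseval K g :
  sum_n (fun l => Cmod (fourier K g (INR l * (2 * PI / INR (S (2 * K))))) ^ 2) (2 * K)
  = INR (S (2 * K)) * energy K g.
Proof.
  unfold energy, symsumR. rewrite <- parseval_nat. apply sum_n_ext; intros l.
  f_equal. set (xi := INR l * _).
  replace (fourier K g xi) with (Cmult (cexp (INR K * xi))
     (sum_n (fun a => Cmult (g (idx K a)) (cexp (- (INR a * xi)))) (2 * K))).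
  - rewrite Cmod_mult, Cmod_cexp, Rmult_1_l. reflexivity.
  - unfold fourier, symsumC. rewrite <- (@sum_n_mult_l C_Ring). apply sum_n_ext; intros a.
    change mult with Cmult.
    replace (- (IZR (idx K a) * xi)) with (INR K * xi + - (INR a * xi)).
    + rewrite cexp_plus. ringC.
    + unfold idx. rewrite minus_IZR, <- !INR_IZR_INZ. ring.
Qed.

(** * The operator norm as the maximum of the symbol *)

Definition supported (D : nat) (g : Z -> C) : Prop :=
  forall j, (Z.of_nat D < Z.abs j)%Z -> g j = RtoC 0.

Lemma supported_nabla_pow m D g : supported D g -> supported (D + m) (nabla_pow m g).
Proof.
  intros H; induction m as [|m IH].
  - now rewrite Nat.add_0_r.
  - intros j Hj. simpl. unfold nabla.
    rewrite !IH by lia. ring.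
Qed.

Lemma symsumC_0 N : symsumC N (fun _ => RtoC 0) = RtoC 0.
Proof.
  transitivity (symsumC N (fun _ => Cmult (RtoC 0) (RtoC 0))).
  - apply (@symsum_ext C_AbelianMonoid); intros; ringC.
  - rewrite symsumC_mult_l. ring.
Qed.

Lemma supported_conv N u D f : supported D f -> supported (D + N) (conv N u f).
Proof.
  intros H j Hj. unfold conv. rewrite <- (symsumC_0 N).
  apply (@symsum_ext C_AbelianMonoid); intros i Hi.
  rewrite H by lia. ringC.
Qed.

Lemma nabla_pow_local m D g h : (forall j, (Z.abs j <= Z.of_nat (D + m))%Z -> g j = h j) ->
  forall k, (Z.abs k <= Z.of_nat D)%Z -> nabla_pow m g k = nabla_pow m h k.
Proof.
  revert D; induction m as [|m IH]; intros D H k Hk.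
  - apply H; lia.
  - simpl. unfold nabla. rewrite !(IH (S D)); auto; try lia; intros; apply H; lia.
Qed.

Lemma conv_local N u D g h : (forall j, (Z.abs j <= Z.of_nat (D + N))%Z -> g j = h j) ->
  forall k, (Z.abs k <= Z.of_nat D)%Z -> conv N u g k = conv N u h k.
Proof.
  intros H k Hk. apply (@symsum_ext C_AbelianMonoid); intros i Hi.
  rewrite H by lia. reflexivity.
Qed.

Lemma fourier_extend N K g xi : (N <= K)%nat -> supported N g -> fourier K g xi = fourier N g xi.
Proof.
  intros L H. apply (@symsum_extend C_AbelianMonoid); auto.
  intros j Hj. rewrite H by auto. apply Cmult_0_l.
Qed.

Lemma fourier_plus K g h xi :
  fourier K (fun j => Cplus (g j) (h j)) xi = Cplus (fourier K g xi) (fourier K h xi).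
Proof.
  unfold fourier. rewrite <- symsumC_plus.
  apply (@symsum_ext C_AbelianMonoid); intros; ringC.
Qed.

Lemma fourier_scal K c g xi : fourier K (fun j => Cmult c (g j)) xi = Cmult c (fourier K g xi).
Proof.
  unfold fourier. rewrite <- symsumC_mult_l.
  apply (@symsum_ext C_AbelianMonoid); intros; ringC.
Qed.

Lemma fourier_shift s K g xi : (forall j, (Z.of_nat K < Z.abs j + Z.abs s)%Z -> g j = RtoC 0) ->
  fourier K (fun j => g (j - s)%Z) xi = Cmult (cexp (- (IZR s * xi))) (fourier K g xi).
Proof.
  intros H. unfold fourier. rewrite <- symsumC_mult_l.
  rewrite <- (@symsum_shift C_AbelianMonoid s K (fun j => Cmult _ (Cmult (g j) _))).
  - apply (@symsum_ext C_AbelianMonoid); intros j _.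
    replace (- (IZR j * xi)) with (- (IZR s * xi) + - (IZR (j - s) * xi)) by (rewrite minus_IZR; ring).
    rewrite cexp_plus. ringC.
  - intros j Hj. rewrite H by auto. change (@zero C_AbelianMonoid) with (RtoC 0). ringC.
Qed.

Lemma uhat_fourier N u xi : uhat N u xi = fourier N (fun j => RtoC (u j)) xi.
Proof.
  apply (@symsum_ext C_AbelianMonoid); intros j _. now rewrite cexp_opp.
Qed.

(** The margin [N] in the hypothesis keeps every translate of [f] inside the window, so that the
    shift rule applies to each. *)
Lemma fourier_conv N u K f xi : (forall j, (Z.of_nat K < Z.abs j + Z.of_nat N)%Z -> f j = RtoC 0) ->
  fourier K (conv N u f) xi = Cmult (uhat N u xi) (fourier K f xi).
Proof.
  intros H. rewrite uhat_fourier.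
  transitivity (symsumC K (fun k => symsumC N (fun j =>
     Cmult (RtoC (u j)) (Cmult (f (k - j)%Z) (cexp (- (IZR k * xi))))))).
  - apply (@symsum_ext C_AbelianMonoid); intros k _. unfold conv.
    rewrite Cmult_comm, <- symsumC_mult_l.
    apply (@symsum_ext C_AbelianMonoid); intros j _. ringC.
  - etransitivity; [exact (@symsum_switch C_AbelianMonoid K N
      (fun k j => Cmult (RtoC (u j)) (Cmult (f (k - j)%Z) (cexp (- (IZR k * xi))))))|].
    unfold fourier at 1. rewrite Cmult_comm, <- symsumC_mult_l.
    apply (@symsum_ext C_AbelianMonoid); intros j Hj.
    change (symsumC K (fun k => Cmult (RtoC (u j)) (Cmult (f (k - j)%Z) (cexp (- (IZR k * xi)))))
      = Cmult (fourier K f xi) (Cmult (RtoC (u j)) (cexp (- (IZR j * xi))))).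
    rewrite symsumC_mult_l.
    change (symsumC K (fun k => Cmult (f (k - j)%Z) (cexp (- (IZR k * xi)))))
      with (fourier K (fun k => f (k - j)%Z) xi).
    rewrite fourier_shift by (intros; apply H; lia). ring.
Qed.

Lemma fourier_nabla K g xi : (forall j, (Z.of_nat K < Z.abs j + 1)%Z -> g j = RtoC 0) ->
  fourier K (nabla g) xi = Cmult (Cminus (cexp xi) (RtoC 1)) (fourier K g xi).
Proof.
  intros H.
  transitivity (fourier K (fun j => Cplus (g (j - -1)%Z) (Cmult (Copp (RtoC 1)) (g j))) xi).
  - apply (@symsum_ext C_AbelianMonoid); intros j _. unfold nabla.
    replace (j - -1)%Z with (j + 1)%Z by lia. ringC.
  - rewrite fourier_plus, fourier_scal, fourier_shift by (intros; apply H; lia).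
    replace (- (-1 * xi)) with xi by ring. ring.
Qed.

Lemma fourier_nabla_pow m D K g xi : supported D g -> (D + m <= K)%nat ->
  fourier K (nabla_pow m g) xi = Cmult (Cpow (Cminus (cexp xi) (RtoC 1)) m) (fourier K g xi).
Proof.
  intros H; induction m as [|m IH]; intros L.
  - simpl. ring.
  - change (nabla_pow (S m) g) with (nabla (nabla_pow m g)).
    rewrite fourier_nabla, IH by (try lia; intros; apply (supported_nabla_pow m D); auto; lia).
    simpl. ring.
Qed.

Definition symbol (m N : nat) (u : Z -> R) (xi : R) : C :=
  Cmult (Cpow (Cminus (cexp xi) (RtoC 1)) m) (uhat N u xi).

Definition nabla_conv (m N : nat) (u : Z -> R) (f : Z -> C) : Z -> C := nabla_pow m (conv N u f).

Lemma fourier_nabla_conv m N u D K f xi : supported D f -> (D + N + m <= K)%nat ->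
  fourier K (nabla_conv m N u f) xi = Cmult (symbol m N u xi) (fourier K f xi).
Proof.
  intros H L. unfold nabla_conv.
  rewrite (fourier_nabla_pow m (D + N)) by (auto using supported_conv).
  rewrite fourier_conv by (intros; apply H; lia).
  unfold symbol. ring.
Qed.

Lemma nabla_conv_local m N u D g h : (forall j, (Z.abs j <= Z.of_nat (D + m + N))%Z -> g j = h j) ->
  forall k, (Z.abs k <= Z.of_nat D)%Z -> nabla_conv m N u g k = nabla_conv m N u h k.
Proof. intros H. apply nabla_pow_local. apply conv_local, H. Qed.

(** Exponentials are eigenfunctions. They are not square summable, so the lower bound for the norm
    is drawn from their truncations. *)
Lemma nabla_conv_cexp m N u xi k :
  nabla_conv m N u (fun j => cexp (IZR j * xi)) k = Cmult (symbol m N u xi) (cexp (IZR k * xi)).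
Proof.
  unfold nabla_conv, symbol. revert k; induction m as [|m IH]; intros k.
  - simpl. unfold conv. rewrite uhat_fourier, Cmult_1_l. unfold fourier.
    rewrite Cmult_comm, <- symsumC_mult_l.
    apply (@symsum_ext C_AbelianMonoid); intros j _.
    replace (IZR (k - j) * xi) with (IZR k * xi + - (IZR j * xi)) by (rewrite minus_IZR; ring).
    rewrite cexp_plus. ringC.
  - change (nabla_pow (S m)) with (fun g => nabla (nabla_pow m g)). cbv beta.
    unfold nabla. rewrite !IH, plus_IZR, Rmult_plus_distr_r, Rmult_1_l, cexp_plus. simpl. ring.
Qed.

(** * Truncation and energy on finite windows *)

Definition trunc (D : nat) (f : Z -> C) (j : Z) : C :=
  if Z_le_dec (Z.abs j) (Z.of_nat D) then f j else RtoC 0.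

Lemma supported_trunc D f : supported D (trunc D f).
Proof. intros j Hj. unfold trunc. destruct (Z_le_dec _ _); auto; lia. Qed.

Lemma trunc_eq D f j : (Z.abs j <= Z.of_nat D)%Z -> trunc D f j = f j.
Proof. intros Hj. unfold trunc. destruct (Z_le_dec _ _); auto; lia. Qed.

Lemma energy_ext K g h : (forall j, (Z.abs j <= Z.of_nat K)%Z -> g j = h j) -> energy K g = energy K h.
Proof. intros H. apply (@symsum_ext R_AbelianMonoid). intros; now rewrite H. Qed.

Lemma energy_S K g : energy (S K) g =
  Cmod (g (- Z.of_nat (S K))%Z) ^ 2 + (energy K g + Cmod (g (Z.of_nat (S K))) ^ 2).
Proof. apply (@symsum_S R_AbelianMonoid K (fun j => Cmod (g j) ^ 2)). Qed.

Lemma energy_le K L g : (K <= L)%nat -> energy K g <= energy L g.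
Proof.
  induction 1 as [|L H IH]; [lra|]. rewrite energy_S.
  pose proof (pow2_ge_0 (Cmod (g (- Z.of_nat (S L))%Z))).
  pose proof (pow2_ge_0 (Cmod (g (Z.of_nat (S L))))). lra.
Qed.

Lemma energy_ge0 K g : 0 <= energy K g.
Proof.
  apply Rle_trans with (energy 0 g); [|apply energy_le; lia].
  unfold energy. rewrite symsumR_symsum, symsum_0. apply pow2_ge_0.
Qed.

Lemma energy_supported D K g : supported D g -> energy K g <= energy D g.
Proof.
  intros H. destruct (Nat.le_ge_cases K D) as [L|L]; [now apply energy_le|].
  apply Req_le, (@symsum_extend R_AbelianMonoid); auto.
  intros j Hj. rewrite H, Cmod_0 by auto. apply (pow_i 2); lia.
Qed.

Lemma energy_eq_0 K g j : energy K g = 0 -> (Z.abs j <= Z.of_nat K)%Z -> g j = RtoC 0.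
Proof.
  revert j; induction K as [|K IH]; intros j H Hj.
  - unfold energy in H. rewrite symsumR_symsum, symsum_0 in H.
    replace j with 0%Z by lia. apply Cmod_eq_0. pose proof (Cmod_ge_0 (g 0%Z)). nra.
  - rewrite energy_S in H.
    pose proof (pow2_ge_0 (Cmod (g (- Z.of_nat (S K))%Z))).
    pose proof (pow2_ge_0 (Cmod (g (Z.of_nat (S K))))).
    pose proof (energy_ge0 K g).
    destruct (Z_le_dec (Z.abs j) (Z.of_nat K)); [apply IH; auto; lra|].
    apply Cmod_eq_0. pose proof (Cmod_ge_0 (g j)).
    assert (Cmod (g j) ^ 2 = 0); [|nra].
    assert (j = Z.of_nat (S K) \/ j = (- Z.of_nat (S K))%Z) as [->| ->] by lia; lra.
Qed.

Lemma fourier_injective K g : (forall xi, fourier K g xi = RtoC 0) ->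
  forall j, (Z.abs j <= Z.of_nat K)%Z -> g j = RtoC 0.
Proof.
  intros H j Hj. apply (energy_eq_0 K); auto.
  assert (P := parseval K g).
  rewrite (sum_n_ext _ (fun _ => 0)) in P.
  - rewrite sum_n_const, Rmult_0_r in P.
    assert (0 < INR (S (2 * K))) by (apply lt_0_INR; lia). nra.
  - intros l. rewrite H, Cmod_0. simpl; ring.
Qed.

(** Links windows to the two half series of [l2norm]. The negative half [{-1..-(K + 1)}] is indexed
    from 0 to [K], hence the window [S K] and the different upper limits. *)
Lemma energy_split K g : energy (S K) g =
  sum_n (fun n => Cmod (g (Z.of_nat n)) ^ 2) (S K) + sum_n (fun n => Cmod (g (- Z.of_nat (S n))%Z) ^ 2) K.
Proof.
  induction K as [|K IH]; rewrite energy_S.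
  - unfold energy. rewrite symsumR_symsum, symsum_0, sum_Sn, !sum_O.
    change plus with Rplus. simpl Z.of_nat. ring.
  - rewrite IH, (sum_Sn _ (S K)), (sum_Sn (fun n => Cmod (g (- Z.of_nat (S n))%Z) ^ 2) K). change plus with Rplus. ring.
Qed.

Lemma ex_series_bounded (a : nat -> R) B : (forall n, 0 <= a n) -> (forall n, sum_n a n <= B) ->
  ex_series a.
Proof.
  intros H0 HB. destruct (ex_finite_lim_seq_incr (sum_n a) B) as [l Hl].
  - intros n. rewrite sum_Sn. change plus with Rplus. specialize (H0 (S n)); lra.
  - auto.
  - now exists l.
Qed.

(** A bound uniform in the window bounds the partial sums of both half series, which gives their
    convergence; the norm estimate follows in the limit. *)
Lemma l2norm_le_of_energy g B : (forall K, energy K g <= B) -> in_l2 g /\ l2norm g <= sqrt B.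
Proof.
  intros H.
  set (a := fun n => Cmod (g (Z.of_nat n)) ^ 2).
  set (b := fun n => Cmod (g (- Z.of_nat (S n))%Z) ^ 2).
  assert (a0 : forall n, 0 <= a n) by (intros; apply pow2_ge_0).
  assert (b0 : forall n, 0 <= b n) by (intros; apply pow2_ge_0).
  assert (S0 : forall c : nat -> R, (forall n, 0 <= c n) -> forall n, 0 <= sum_n c n).
  { intros c c0 n. induction n; [rewrite sum_O; auto|].
    rewrite sum_Sn. change plus with Rplus. specialize (c0 (S n)); lra. }
  assert (HS : forall K, sum_n a (S K) + sum_n b K <= B)
    by (intros K; specialize (H (S K)); now rewrite energy_split in H).
  assert (Ha : ex_series a).
  { apply ex_series_bounded with B; auto. intros n. specialize (HS n).
    rewrite sum_Sn in HS. change plus with Rplus in HS.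
    specialize (S0 b b0 n); specialize (a0 (S n)); lra. }
  assert (Hb : ex_series b).
  { apply ex_series_bounded with B; auto. intros n. specialize (HS n).
    specialize (S0 a a0 (S n)); lra. }
  split; [split; auto|].
  apply sqrt_le_1_alt.
  assert (La := Series_correct a Ha). assert (Lb := Series_correct b Hb).
  refine (is_lim_seq_le (fun K => sum_n a (S K) + sum_n b K) (fun _ => B) (Finite _) (Finite _) HS _ _).
  - apply is_lim_seq_plus'.
    + apply (is_lim_seq_incr_1 (sum_n a)). exact La.
    + exact Lb.
  - apply is_lim_seq_const.
Qed.

Lemma energy_le_l2norm g K : in_l2 g -> energy K g <= l2norm g ^ 2.
Proof.
  intros [Ha Hb]. unfold l2norm.
  set (a := fun n => Cmod (g (Z.of_nat n)) ^ 2) in *.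
  set (b := fun n => Cmod (g (- Z.of_nat (S n))%Z) ^ 2) in *.
  assert (P : forall c : nat -> R, (forall n, 0 <= c n) -> ex_series c -> forall n, sum_n c n <= Series c).
  { intros c c0 Hc n. apply (is_lim_seq_incr_compare (sum_n c)).
    - apply (Series_correct c Hc).
    - intros i. rewrite sum_Sn. change plus with Rplus. specialize (c0 (S i)); lra. }
  assert (a0 : forall n, 0 <= a n) by (intros; apply pow2_ge_0).
  assert (b0 : forall n, 0 <= b n) by (intros; apply pow2_ge_0).
  assert (E : energy K g <= Series a + Series b).
  { eapply Rle_trans; [apply (energy_le K (S K)); lia|]. rewrite energy_split.
    apply Rplus_le_compat; apply P; auto. }
  rewrite pow2_sqrt; auto. pose proof (energy_ge0 K g); lra.
Qed.

Lemma l2norm_ge0 g : 0 <= l2norm g.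
Proof. apply sqrt_pos. Qed.

Lemma l2norm_pos g : in_l2 g -> (exists k, g k <> RtoC 0) -> 0 < l2norm g.
Proof.
  intros H [k Hk]. destruct (Rle_lt_or_eq_dec 0 (l2norm g) (l2norm_ge0 g)) as [|E]; auto.
  exfalso; apply Hk. apply (energy_eq_0 (Z.to_nat (Z.abs k))); [|lia].
  pose proof (energy_le_l2norm g (Z.to_nat (Z.abs k)) H).
  pose proof (energy_ge0 (Z.to_nat (Z.abs k)) g). rewrite <- E in *. simpl in *. lra.
Qed.

(** Parseval on both sides reduces the claim to a termwise comparison at the sampled frequencies;
    the window is large enough to hold the whole output. *)
Lemma energy_nabla_conv_supported m N u s D K f : (forall xi, Cmod (symbol m N u xi) <= s) ->
  supported D f -> (D + N + m <= K)%nat -> energy K (nabla_conv m N u f) <= s ^ 2 * energy K f.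
Proof.
  intros Hs Hf L.
  assert (HL : 0 < INR (S (2 * K))) by (apply lt_0_INR; lia).
  apply Rmult_le_reg_l with (INR (S (2 * K))); auto.
  rewrite <- parseval.
  replace (INR (S (2 * K)) * (s ^ 2 * energy K f)) with (s ^ 2 * (INR (S (2 * K)) * energy K f)) by ring.
  rewrite <- parseval, <- (@sum_n_mult_l R_Ring).
  rewrite !sum_n_Reals. apply sum_Rle. intros l _.
  rewrite (fourier_nabla_conv m N u D), Cmod_mult by auto.
  change mult with Rmult. rewrite Rpow_mult_distr.
  apply Rmult_le_compat_r; [apply pow2_ge_0|].
  apply pow_incr; split; [apply Cmod_ge_0|auto].
Qed.

Lemma l2norm_nabla_conv m N u s f : (forall xi, Cmod (symbol m N u xi) <= s) ->
  in_l2 f -> l2norm (nabla_conv m N u f) <= s * l2norm f.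
Proof.
  intros Hs Hf.
  assert (s0 : 0 <= s) by (eapply Rle_trans; [apply Cmod_ge_0|apply (Hs 0)]).
  destruct (l2norm_le_of_energy (nabla_conv m N u f) ((s * l2norm f) ^ 2)) as [_ H].
  (* On [{-K..K}] the output depends on [f] only through [{-D..D}], so [f] may be truncated; the
     window [K'] then contains the whole output of the truncation. *)
  - intros K. set (D := (K + m + N)%nat). set (K' := (D + N + m)%nat).
    rewrite (energy_ext K _ (nabla_conv m N u (trunc D f))).
    2:{ apply nabla_conv_local. intros; rewrite trunc_eq; auto. }
    eapply Rle_trans; [apply (energy_le K K'); lia|].
    eapply Rle_trans; [apply energy_nabla_conv_supported with (s := s) (D := D); auto using supported_trunc|].
    rewrite Rpow_mult_distr. apply Rmult_le_compat_l; [apply pow2_ge_0|].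
    eapply Rle_trans; [apply energy_supported, supported_trunc|].
    rewrite (energy_ext D _ f) by (intros; apply trunc_eq; auto).
    now apply energy_le_l2norm.
  - rewrite sqrt_pow2 in H; auto. apply Rmult_le_pos; auto using l2norm_ge0.
Qed.

Lemma energy_unimodular K g : (forall j, (Z.abs j <= Z.of_nat K)%Z -> Cmod (g j) = 1) ->
  energy K g = INR (S (2 * K)).
Proof.
  intros H. unfold energy. rewrite symsumR_symsum.
  rewrite (symsum_ext K _ (fun _ => 1)) by (intros; rewrite H; auto; apply (pow1 2)).
  unfold symsum. rewrite sum_n_const. ring.
Qed.

(* Tested on the truncations of [j |-> exp(i j xi)] to longer and longer windows. *)
Lemma symbol_le_of_l2norm m N u r xi :
  (forall f, in_l2 f -> (exists k, f k <> RtoC 0) -> l2norm (nabla_conv m N u f) / l2norm f <= r) ->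
  Cmod (symbol m N u xi) <= r.
Proof.
  intros H. set (s := Cmod (symbol m N u xi)).
  set (D := (m + N)%nat).
  (* The input window exceeds [{-i..i}] by [D] on each side; this adds [2 * D] to the energy of the
     input, which is negligible as [i] grows. *)
  assert (Main : 0 <= r /\ forall i : nat, s ^ 2 * (2 * INR i + 1) <= r ^ 2 * (2 * INR i + 1 + 2 * INR D)).
  { assert (forall i : nat, 0 <= r /\ s ^ 2 * (2 * INR i + 1) <= r ^ 2 * (2 * INR i + 1 + 2 * INR D)); [|split; apply H0; exact O].
    intros i. set (K := (i + D)%nat). set (f := trunc K (fun j => cexp (IZR j * xi))).
    assert (Sf : supported K f) by apply supported_trunc.
    assert (Uf : forall j, (Z.abs j <= Z.of_nat K)%Z -> Cmod (f j) = 1)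
      by (intros; unfold f; rewrite trunc_eq, Cmod_cexp; auto).
    assert (EK : INR (S (2 * K)) = 2 * INR i + 1 + 2 * INR D).
    { unfold K. rewrite S_INR, mult_INR, plus_INR. simpl (INR 2). ring. }
    destruct (l2norm_le_of_energy f (INR (S (2 * K)))) as [L1 L2].
    { intros K'. rewrite <- (energy_unimodular K f Uf). now apply energy_supported. }
    assert (Nz : exists k, f k <> RtoC 0).
    { exists 0%Z. intros E. specialize (Uf 0%Z). rewrite E, Cmod_0 in Uf. specialize (Uf ltac:(lia)). lra. }
    assert (Pf := l2norm_pos f L1 Nz).
    specialize (H f L1 Nz).
    assert (r0 : 0 <= r).
    { eapply Rle_trans; [|exact H]. apply Rmult_le_pos; [apply l2norm_ge0|].
      apply Rlt_le, Rinv_0_lt_compat; auto. }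
    split; auto.
    apply Rle_div_l in H; auto.
    destruct (l2norm_le_of_energy (nabla_conv m N u f) (energy (K + N + m) (nabla_conv m N u f))) as [T1 _].
    { intros K'. apply energy_supported. apply supported_nabla_pow, supported_conv; auto. }
    assert (T2 := energy_le_l2norm _ i T1).
    (* Inside [{-i..i}] the truncation is not felt, and every value of the output has modulus
       [s]. *)
    assert (Ei : energy i (nabla_conv m N u f) = s ^ 2 * (2 * INR i + 1)).
    { replace (2 * INR i + 1) with (INR (S (2 * i))) by (rewrite S_INR, mult_INR; simpl (INR 2); ring).
      rewrite <- (energy_unimodular i (fun j => cexp (IZR j * xi))) by (intros; apply Cmod_cexp).
      unfold energy. rewrite !symsumR_symsum, <- (@symsum_mult_l R_Ring).
      apply symsum_ext; intros j Hj.
      rewrite (nabla_conv_local m N u i f (fun j => cexp (IZR j * xi))); auto.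
      - rewrite nabla_conv_cexp, Cmod_mult. apply Rpow_mult_distr.
      - intros; apply trunc_eq. unfold K, D; lia. }
    rewrite Ei in T2. eapply Rle_trans; [exact T2|]. rewrite <- EK.
    apply Rle_trans with ((r * l2norm f) ^ 2).
    - apply pow_incr; split; auto using l2norm_ge0.
    - rewrite Rpow_mult_distr. apply Rmult_le_compat_l; [apply pow2_ge_0|].
      rewrite <- (pow2_sqrt (INR (S (2 * K)))) by apply pos_INR.
      apply pow_incr; split; auto using l2norm_ge0. }
  destruct Main as [r0 Main].
  assert (s0 : 0 <= s) by apply Cmod_ge_0.
  destruct (Rle_dec s r) as [|N0]; auto. exfalso.
  assert (Hlt : 0 < s ^ 2 - r ^ 2) by nra.
  destruct (INR_unbounded (r ^ 2 * 2 * INR D / (s ^ 2 - r ^ 2))) as [i Hi].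
  apply Rlt_div_l in Hi; auto. specialize (Main i). pose proof (pos_INR i). nra.
Qed.

Lemma opnorm_eq m N u s : (forall xi, Cmod (symbol m N u xi) <= s) ->
  (exists xi, Cmod (symbol m N u xi) = s) -> opnorm m N u = Finite s.
Proof.
  intros Hs [xi Hxi]. apply is_lub_Rbar_unique. split.
  - intros r (f & Hf & Nz & ->). simpl.
    apply Rle_div_l; [apply l2norm_pos; auto|]. apply l2norm_nabla_conv; auto.
  - intros b Hb.
    (* Stated for all reals [r] above the extended real [b], so that [b] equal to minus infinity is
       refuted by [r = s - 1]. *)
    assert (Q : forall r, (Rbar_le b (Finite r)) -> s <= r).
    { intros r Hr. rewrite <- Hxi. apply symbol_le_of_l2norm. intros f Hf Nz.
      change (Rbar_le (Finite (l2norm (nabla_conv m N u f) / l2norm f)) (Finite r)).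
      eapply Rbar_le_trans; [|exact Hr]. apply Hb. exists f; auto. }
    destruct b as [b| |]; simpl; auto.
    + apply Q. simpl; lra.
    + specialize (Q (s - 1) I). lra.
Qed.

Lemma symbol_le_opnorm m N u r : opnorm m N u = Finite r -> forall xi, Cmod (symbol m N u xi) <= r.
Proof.
  intros E xi. apply symbol_le_of_l2norm. intros f Hf Nz.
  destruct (Lub_Rbar_correct (fun r : R => exists f : Z -> C,
    in_l2 f /\ (exists k : Z, f k <> RtoC 0) /\
    r = l2norm (nabla_pow m (conv N u f)) / l2norm f)) as [U _].
  fold (opnorm m N u) in U. rewrite E in U.
  apply (U (l2norm (nabla_conv m N u f) / l2norm f)). exists f; auto.
Qed.

(** * Even kernels and polynomials in the cosine *)

Lemma uhat_even_poly N u : (forall j, u j = u (- j)%Z) ->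
  exists p, is_poly N p /\ forall xi, uhat N u xi = RtoC (p (cos xi)).
Proof.
  (* Chebyshev polynomials of degrees [d] and [d + 1], carried as a pair for the recurrence [cos ((d
     + 2) xi) = 2 cos xi cos ((d + 1) xi) - cos (d xi)]. *)
  assert (T : forall d, exists p q, is_poly d p /\ is_poly (S d) q /\
    forall xi, p (cos xi) = cos (INR d * xi) /\ q (cos xi) = cos (INR (S d) * xi)).
  { induction d as [|d (p & q & Hp & Hq & E)].
    - exists (fun _ => 1), (fun x => x). split; [now exists 1|split].
      + exists 0, (fun _ => 1). split; [now exists 1|intros; ring].
      + intros xi. simpl. rewrite Rmult_0_l, cos_0, Rmult_1_l. auto.
    - exists q, (fun x => 2 * (x * q x) + -1 * p x). split; [auto|split].
      + apply is_poly_plus; apply is_poly_scal; [apply (is_poly_mulX (S d)); auto|auto using is_poly_S].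
      + intros xi. destruct (E xi) as [E1 E2]. split; auto. rewrite E1, E2.
        replace (INR (S (S d)) * xi) with (INR (S d) * xi + xi) by (rewrite (S_INR (S d)); ring).
        replace (INR d * xi) with (INR (S d) * xi - xi) by (rewrite (S_INR d); ring).
        rewrite cos_plus, cos_minus. ring. }
  intros He. induction N as [|N (p & Hp & E)].
  - exists (fun _ => u 0%Z). split; [now exists (u 0%Z)|]. intros xi.
    rewrite uhat_fourier. unfold fourier. rewrite symsumC_symsum, symsum_0.
    rewrite Rmult_0_l, Ropp_0, cexp_0. ringC.
  - destruct (T (S N)) as (q & q' & Hq & _ & Eq).
    exists (fun x => p x + 2 * u (Z.of_nat (S N)) * q x). split.
    + apply is_poly_plus; [apply is_poly_S; auto|apply is_poly_scal; auto].
    + intros xi. rewrite RtoC_plus, <- E, !uhat_fourier. unfold fourier at 1.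
      rewrite symsumC_symsum, symsum_S. change plus with Cplus.
      rewrite <- symsumC_symsum. fold (fourier N (fun j => RtoC (u j)) xi).
      rewrite <- He. destruct (Eq xi) as [-> _].
      rewrite opp_IZR, <- INR_IZR_INZ.
      replace (- (- INR (S N) * xi)) with (INR (S N) * xi) by ring.
      replace (2 * u (Z.of_nat (S N)) * cos (INR (S N) * xi)) with
        (u (Z.of_nat (S N)) * (2 * cos (INR (S N) * xi))) by ring.
      rewrite RtoC_mult, <- cexp_sym. ringC.
Qed.

(** Induction on the Horner form: multiplying the transform by [cos xi] averages the two unit
    translates of the kernel, and a constant is the transform of a multiple of the unit mass at
    0. *)
Lemma poly_uhat N p : is_poly N p -> exists u,
  (forall j, (Z.of_nat N < Z.abs j)%Z -> u j = 0) /\ (forall j, u j = u (- j)%Z) /\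
  forall xi, uhat N u xi = RtoC (p (cos xi)).
Proof.
  revert p; induction N as [|N IH]; intros p Hp.
  - destruct Hp as [c Hc]. exists (fun j => if Z.eq_dec j 0 then c else 0). split; [|split].
    + intros j Hj. destruct (Z.eq_dec j 0); auto; lia.
    + intros j. destruct (Z.eq_dec j 0), (Z.eq_dec (- j) 0); auto; lia.
    + intros xi. rewrite uhat_fourier. unfold fourier. rewrite symsumC_symsum, symsum_0, Hc. simpl.
      rewrite Rmult_0_l, Ropp_0, cexp_0. ringC.
  - destruct Hp as (c & g & Hg & Ep). destruct (IH g Hg) as (v & V1 & V2 & V3).
    exists (fun j => (if Z.eq_dec j 0 then c else 0) + / 2 * (v (j - 1)%Z + v (j - -1)%Z)).
    split; [|split].
    + intros j Hj. rewrite !V1 by lia. destruct (Z.eq_dec j 0); [lia|ring].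
    + intros j. rewrite (V2 (- j - 1)%Z), (V2 (- j - -1)%Z).
      replace (- (- j - 1))%Z with (j - -1)%Z by lia. replace (- (- j - -1))%Z with (j - 1)%Z by lia.
      destruct (Z.eq_dec j 0), (Z.eq_dec (- j) 0); try lia; ring.
    + intros xi. rewrite uhat_fourier.
      set (e := fun j => RtoC (if Z.eq_dec j 0 then c else 0)).
      set (w := fun j => RtoC (v j)).
      transitivity (fourier (S N) (fun j => Cplus (e j)
        (Cmult (RtoC (/ 2)) (Cplus (w (j - 1)%Z) (w (j - -1)%Z)))) xi).
      { apply (@symsum_ext C_AbelianMonoid); intros j _. unfold e, w.
        rewrite RtoC_plus, RtoC_mult, RtoC_plus. reflexivity. }
      assert (Sw : supported N w) by (intros j Hj; unfold w; rewrite V1; auto).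
      rewrite fourier_plus, fourier_scal, fourier_plus.
      rewrite !fourier_shift by (intros; apply Sw; lia).
      rewrite !(fourier_extend N (S N) w) by auto.
      change (fourier N w xi) with (fourier N (fun j => RtoC (v j)) xi).
      rewrite <- uhat_fourier, V3.
      rewrite (fourier_extend 0 (S N) e); [|lia|].
      2:{ intros j Hj. unfold e. destruct (Z.eq_dec j 0); auto; lia. }
      unfold fourier. rewrite symsumC_symsum, symsum_0. unfold e. simpl (Z.eq_dec 0 0). cbv iota.
      rewrite Rmult_0_l, Ropp_0, cexp_0, Ep.
      replace (- (1 * xi)) with (- xi) by ring. replace (- (-1 * xi)) with xi by ring.
      replace (cos xi * g (cos xi)) with (/ 2 * (2 * cos xi * g (cos xi))) by field.
      rewrite RtoC_plus, !(RtoC_mult (/ 2)), (RtoC_mult (2 * cos xi)), <- cexp_sym. ringC.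
Qed.

Lemma uhat_0 N u : uhat N u 0 = RtoC (symsumR N u).
Proof.
  rewrite uhat_fourier, RtoC_symsum. apply (@symsum_ext C_AbelianMonoid). intros j _.
  rewrite Rmult_0_r, Ropp_0, cexp_0. ringC.
Qed.

Lemma uhat_injective N u w : (forall j, (Z.of_nat N < Z.abs j)%Z -> u j = 0) ->
  (forall j, (Z.of_nat N < Z.abs j)%Z -> w j = 0) ->
  (forall xi, uhat N u xi = uhat N w xi) -> u = w.
Proof.
  intros Hu Hw E. apply functional_extensionality; intros j.
  destruct (Z_le_dec (Z.abs j) (Z.of_nat N)) as [L|L].
  2:{ rewrite Hu, Hw by lia; auto. }
  assert (Z0 : Cplus (RtoC (u j)) (Cmult (Copp (RtoC 1)) (RtoC (w j))) = RtoC 0).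
  { apply (fourier_injective N (fun j => Cplus (RtoC (u j)) (Cmult (Copp (RtoC 1)) (RtoC (w j))))); auto.
    intros xi. rewrite fourier_plus, fourier_scal, <- !uhat_fourier, E. ring. }
  apply RtoC_inj. rewrite <- (Cplus_0_l (RtoC (w j))), <- Z0. ring.
Qed.

Lemma convR_supported n u : (forall j, (Z.of_nat n < Z.abs j)%Z -> u j = 0) ->
  forall j, (Z.of_nat (2 * n) < Z.abs j)%Z -> convR n u u j = 0.
Proof.
  intros H j Hj. unfold convR. rewrite symsumR_symsum.
  rewrite (symsum_ext n _ (fun _ => 0)).
  - unfold symsum. rewrite sum_n_const. ring.
  - intros i Hi. rewrite (H (j - i)%Z) by lia. apply Rmult_0_r.
Qed.

Lemma convR_even n u : (forall j, u j = u (- j)%Z) ->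
  forall j, convR n u u j = convR n u u (- j)%Z.
Proof.
  intros H j. unfold convR. rewrite !symsumR_symsum, <- symsum_opp.
  apply symsum_ext; intros i _. rewrite <- H, (H (- j - i)%Z). do 2 f_equal; lia.
Qed.

Lemma uhat_convR n u xi : (forall j, (Z.of_nat n < Z.abs j)%Z -> u j = 0) ->
  uhat (2 * n) (convR n u u) xi = Cmult (uhat n u xi) (uhat n u xi).
Proof.
  intros H. rewrite (uhat_fourier (2 * n)).
  assert (S : supported n (fun j => RtoC (u j))) by (intros j Hj; rewrite H; auto).
  transitivity (fourier (2 * n) (conv n u (fun j => RtoC (u j))) xi).
  - apply (@symsum_ext C_AbelianMonoid); intros k _. f_equal.
    unfold convR, conv. rewrite RtoC_symsum.
    apply (@symsum_ext C_AbelianMonoid); intros j _. apply RtoC_mult.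
  - rewrite fourier_conv by (intros; apply S; lia).
    rewrite (fourier_extend n) by (auto; lia). now rewrite <- uhat_fourier.
Qed.

Lemma Cmod_symbol_sqr m N u xi c : uhat N u xi = RtoC c ->
  Cmod (symbol m N u xi) ^ 2 = wt m (cos xi) * c ^ 2.
Proof.
  intros E. unfold symbol, wt. rewrite Cmod_mult, Cmod_pow, E, Cmod_R, Rpow_mult_distr.
  rewrite pow2_abs, <- pow_mult, Nat.mul_comm, pow_mult. f_equal. f_equal.
  rewrite Cmod2_alt. unfold cexp; simpl.
  pose proof (sin2_cos2 xi) as P. unfold Rsqr in P.
  replace (_ + _) with (2 - 2 * cos xi + ((sin xi * sin xi + cos xi * cos xi) - 1)) by ring. lra.
Qed.

Lemma cos_acos_ex x : -1 <= x <= 1 -> exists xi, cos xi = x.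
Proof. intros Hx; exists (acos x). now apply cos_acos. Qed.

Lemma Glb_attained (Q : R -> Prop) s : Q s -> (forall r, Q r -> s <= r) -> Glb_Rbar Q = Finite s.
Proof.
  intros H1 H2. apply is_glb_Rbar_unique. split.
  - intros r Hr. simpl; auto.
  - intros b Hb. apply (Hb s H1).
Qed.

Theorem theorem1p8 (k n : nat) (hk : (0 < k)%nat) (hn : (0 < n)%nat) :
  Rbar_mult (Cconst k n 1) (Cconst k n 1) = Cconst (2 * k) (2 * n) 2 /\
  exists u : Z -> R,
    (inF1 n u /\ Cconst k n 1 = opnorm k n u) /\
    (forall w : Z -> R, inF1 n w -> Cconst k n 1 = opnorm k n w -> w = u) /\
    (inF2 (2 * n) (convR n u u) /\
     Cconst (2 * k) (2 * n) 2 = opnorm (2 * k) (2 * n) (convR n u u)) /\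
    (forall w : Z -> R, inF2 (2 * n) w ->
       Cconst (2 * k) (2 * n) 2 = opnorm (2 * k) (2 * n) w -> w = convR n u u).
Proof.
  destruct (extremal_polynomial k n hk hn) as (p & M & Hp & p1 & HM & Hb & (x0 & Hx0 & Ex0) & Ext).
  destruct (poly_uhat n p Hp) as (u & U1 & U2 & U3).
  destruct (cos_acos_ex x0 Hx0) as [xi0 Exi0].
  assert (UU : forall xi, uhat (2 * n) (convR n u u) xi = RtoC (p (cos xi) ^ 2)).
  { intros xi. rewrite uhat_convR, U3, <- RtoC_mult by auto. f_equal; ring. }
  assert (Hu : inF1 n u).
  { split; [auto|split; auto]. apply RtoC_inj. rewrite <- uhat_0, U3, cos_0, p1; auto. }
  assert (Huu : inF2 (2 * n) (convR n u u)).
  { split; [split; [now apply convR_supported|split; [now apply convR_even|]]|].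
    - apply RtoC_inj. rewrite <- uhat_0, UU, cos_0, p1. f_equal; ring.
    - intros xi. rewrite UU. split; [apply im_RtoC|]. rewrite re_RtoC. apply pow2_ge_0. }
  assert (O1 : opnorm k n u = Finite (sqrt M)).
  { apply opnorm_eq.
    - intros xi. rewrite <- (sqrt_pow2 (Cmod _)) by apply Cmod_ge_0.
      apply sqrt_le_1_alt. rewrite (Cmod_symbol_sqr k n u xi _ (U3 xi)).
      apply Hb, COS_bound.
    - exists xi0. rewrite <- (sqrt_pow2 (Cmod _)) by apply Cmod_ge_0. f_equal.
      rewrite (Cmod_symbol_sqr k n u xi0 _ (U3 xi0)), Exi0; auto. }
  (* At order [2 * k], the symbol of the convolution square has as modulus the squared modulus of
     the symbol of [u] at order [k]; its maximum is therefore [M]. *)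
  assert (W2 : forall xi, Cmod (symbol (2 * k) (2 * n) (convR n u u) xi) = wt k (cos xi) * p (cos xi) ^ 2).
  { intros xi. rewrite <- (sqrt_pow2 (Cmod _)) by apply Cmod_ge_0.
    rewrite (Cmod_symbol_sqr _ _ _ xi _ (UU xi)).
    replace (wt (2 * k) _) with (wt k (cos xi) ^ 2) by (unfold wt; rewrite <- pow_mult; f_equal; lia).
    rewrite <- Rpow_mult_distr. apply sqrt_pow2.
    apply Rmult_le_pos; [apply wt_ge0, COS_bound|apply pow2_ge_0]. }
  assert (O2 : opnorm (2 * k) (2 * n) (convR n u u) = Finite M).
  { apply opnorm_eq.
    - intros xi. rewrite W2. apply Hb, COS_bound.
    - exists xi0. rewrite W2, Exi0; auto. }
  (* Serves both the value and the uniqueness: a norm below [sqrt M] and a norm equal to it lead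
     alike to [w = u]. *)
  assert (L1 : forall w r, inF1 n w -> opnorm k n w = Finite r -> r <= sqrt M -> w = u).
  { intros w r (S1 & S2 & S3) Ew Hr.
    destruct (uhat_even_poly n w S2) as (q & Hq & Eq).
    assert (q1 : q 1 = 1).
    { assert (E := Eq 0). rewrite uhat_0, S3, cos_0 in E. now apply RtoC_inj. }
    assert (Bq : below k q M).
    { intros x Hx. destruct (cos_acos_ex x Hx) as [xi <-].
      rewrite <- (Cmod_symbol_sqr k n w xi _ (Eq xi)), <- (pow2_sqrt M) by lra.
      apply pow_incr; split; [apply Cmod_ge_0|].
      eapply Rle_trans; [apply (symbol_le_opnorm _ _ _ _ Ew)|]; auto. }
    assert (Sq : forall q', is_poly n q' -> q' 1 = 1 -> below k q' M -> forall x, q' x ^ 2 = p x ^ 2).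
    { intros q' H1 H2 H3. apply (Ext (fun x => q' x ^ 2)).
      - apply is_poly_pow; auto.
      - rewrite H2; ring.
      - intros; apply pow2_ge_0.
      - auto. }
    assert (Q1 := Sq q Hq q1 Bq).
    (* From [q ^ 2 = p ^ 2] there follows only [q = p] or [q = - p] at each point. The mean of [q]
       and [p] is admissible by convexity of the square, and [((q + p) / 2) ^ 2 = p ^ 2] excludes
       the second case wherever [p] is nonzero. *)
    assert (Q2 := Sq (fun x => / 2 * (q x + p x))).
    apply (uhat_injective n); auto. intros xi. rewrite Eq, U3. f_equal.
    specialize (Q1 (cos xi)).
    assert (Q3 : (/ 2 * (q (cos xi) + p (cos xi))) ^ 2 = p (cos xi) ^ 2).
    { apply Q2.
      - apply is_poly_scal, is_poly_plus; auto.
      - rewrite q1, p1; field.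
      - intros x Hx. specialize (Bq x Hx). specialize (Hb x Hx).
        assert (W := wt_ge0 k x (proj2 Hx)).
        apply Rle_trans with (/ 2 * (wt k x * q x ^ 2 + wt k x * p x ^ 2)); [|lra].
        assert (0 <= wt k x * (q x - p x) ^ 2) by (apply Rmult_le_pos; auto; apply pow2_ge_0).
        nra. }
    nra. }
  (* Here [Ext] applies to [q] itself: [q] is nonnegative on [[-1, 1]], so the symbol of [w] has
     modulus [wt k (cos xi) * q (cos xi)]. *)
  assert (L2 : forall w r, inF2 (2 * n) w -> opnorm (2 * k) (2 * n) w = Finite r -> r <= M -> w = convR n u u).
  { intros w r ((S1 & S2 & S3) & S4) Ew Hr.
    destruct (uhat_even_poly (2 * n) w S2) as (q & Hq & Eq).
    assert (q0 : forall x, -1 <= x <= 1 -> 0 <= q x).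
    { intros x Hx. destruct (cos_acos_ex x Hx) as [xi <-].
      destruct (S4 xi) as [_ P]. rewrite Eq, re_RtoC in P; auto. }
    apply (uhat_injective (2 * n)); auto.
    { apply convR_supported; auto. }
    intros xi. rewrite Eq, UU. f_equal. apply Ext; auto.
    - assert (E := Eq 0). rewrite uhat_0, S3, cos_0 in E. now apply RtoC_inj.
    - intros x Hx. specialize (q0 x Hx). destruct (cos_acos_ex x Hx) as [t <-].
      eapply Rle_trans; [|exact Hr]. eapply Rle_trans; [|apply (symbol_le_opnorm _ _ _ _ Ew t)].
      rewrite <- (sqrt_pow2 (Cmod _)) by apply Cmod_ge_0.
      rewrite (Cmod_symbol_sqr _ _ _ t _ (Eq t)).
      replace (wt (2 * k) _) with (wt k (cos t) ^ 2) by (unfold wt; rewrite <- pow_mult; f_equal; lia).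
      rewrite <- Rpow_mult_distr, sqrt_pow2; [lra|].
      apply Rmult_le_pos; auto. apply wt_ge0, COS_bound. }
  assert (C1 : Cconst k n 1 = Finite (sqrt M)).
  { apply Glb_attained.
    - exists u; auto.
    (* A competitor with a smaller norm would be [u], whose norm is [sqrt M]. *)
    - intros r (w & Hw & Ew). destruct (Rle_dec (sqrt M) r) as [|N]; auto.
      assert (w = u) by (apply (L1 w r); auto; lra). subst w.
      rewrite O1 in Ew. injection Ew; lra. }
  assert (C2 : Cconst (2 * k) (2 * n) 2 = Finite M).
  { apply Glb_attained.
    - exists (convR n u u); auto.
    - intros r (w & Hw & Ew). destruct (Rle_dec M r) as [|N]; auto.
      assert (w = convR n u u) by (apply (L2 w r); auto; lra). subst w.
      rewrite O2 in Ew. injection Ew; lra. }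
  split.
  - rewrite C1, C2. simpl. f_equal. apply sqrt_sqrt; lra.
  - exists u. rewrite C1, C2. split; [|split; [|split]]; auto.
    + intros w Hw Ew. apply (L1 w (sqrt M)); auto; lra.
    + intros w Hw Ew. apply (L2 w M); auto; lra.
Qed.
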